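(* Let $d\ge 2$, $q\in[1,\infty)$ and $r\in[1,\infty]$, and let $\mathcal X$ and $\mathcal Y$ be compact and convex subsets of $\mathbb R^d$. Let $M>0$, $\theta\in(0,1]$, and let $\tilde\rho$ be a probability measure on $\mathcal X$ satisfying $\tilde\rho(B_\eta(x))\le M\eta^{d-1+\theta}$ for every $x\in\mathbb R^d$ and $\eta>0$. Then for all $\rho\in\mathcal P(\mathcal X)$ and $\mu\in\mathcal P(\mathcal Y)$, $$\operatorname{diam}_{W_q}\Gamma(\rho,\mu)\le C\,W_r(\rho,\tilde\rho)^{\nu},$$ where $\nu\in(0,1]$ is given by $\nu=\frac{r\theta}{q(r+\theta)}$ if $r<\infty$ and $\nu=\frac{\theta}{q}$ if $r=\infty$, and $$C=D_{\mathcal Y}\left(c_dMD_{\mathcal X}^{d-1+\theta}+1\right)^{1/q}D_{\mathcal X}^{-\nu}>0.$$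
   Context: $\mathcal P(E)$ is the set of Borel probability measures on $E$ (viewed as measures on the ambient Euclidean space), and $B_\eta(x)$ is the open Euclidean ball. $D_{\mathcal X}=\operatorname{diam}(\mathcal X)$, $D_{\mathcal Y}=\operatorname{diam}(\mathcal Y)$. $\beta_k$ is the volume of the unit ball of $\mathbb R^k$ and $c_d=\frac43\,\frac{6^d d^2(d+1)\beta_d}{\beta_{d-1}}$. $\Pi(\rho,\mu)$ is the set of couplings (transport plans) of $\rho$ and $\mu$. $\Gamma(\rho,\mu)$ is the set of minimisers of $\int\|x-y\|^2\,d\gamma(x,y)$ over $\gamma\in\Pi(\rho,\mu)$ (optimal plans). For $r\in[1,\infty]$ and measures on $\mathbb R^d$, $W_r(\rho,\mu)=\min_{\gamma\in\Pi(\rho,\mu)}\|x-y\|_{L^r(\gamma)}$. For $q\in[1,\infty)$ and probability measures $\gamma_0,\gamma_1$ on $\mathbb R^d\times\mathbb R^d$, $W_q$ is taken with respect to the norm $\|(x,y)\|=(\|x\|^q+\|y\|^q)^{1/q}$, i.e. $W_q^q(\gamma_0,\gamma_1)=\inf_{\pi\in\Pi(\gamma_0,\gamma_1)}\int\|x_0-x_1\|^q+\|y_0-y_1\|^q\,d\pi(x_0,y_0,x_1,y_1)$. Finally $\operatorname{diam}_{W_q}\Gamma(\rho,\mu)=\sup_{\gamma_0,\gamma_1\in\Gamma(\rho,\mu)}W_q(\gamma_0,\gamma_1)$.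
   Formalization: The claim C > 0 is stated only when D_Y > 0, because C = 0 when Y is a single point; the main inequality is proved without this restriction. *)

(* Defs.v *)
From HB Require Import structures.
From mathcomp Require Import all_boot all_order all_algebra.
From mathcomp Require Import all_classical all_reals all_analysis.

Set Implicit Arguments.
Unset Strict Implicit.
Unset Printing Implicit Defensive.

Import Order.TTheory GRing.Theory Num.Theory.
Import numFieldNormedType.Exports.

Local Open Scope classical_set_scope.
Local Open Scope ring_scope.

(* Borel sigma-algebra on matrices, hence on R^d = 'rV[R]_d. *)
HB.instance Definition _ (R : realType) (m n : nat) :=
  @isMeasurable.Build (sigma_display (@open 'M[R]_(m, n))) 'M[R]_(m, n)
    <<s @open 'M[R]_(m, n) >> (@sigma_algebra0 _ setT _)
    (@sigma_algebraC _ _) (@sigma_algebra_bigcup _ setT _).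

Section Euclidean.
Variables (R : realType) (d : nat).

(* The library norm `|v| on 'rV[R]_d is the sup norm, which induces the same
   topology and Borel sets, but not the same balls or diameters. *)
Definition enorm (v : 'rV[R]_d) : R := Num.sqrt (\sum_(i < d) v 0 i ^+ 2).

Definition eball (x : 'rV[R]_d) (eta : R) : set 'rV[R]_d :=
  [set y | enorm (y - x) < eta].

Definition ediam (A : set 'rV[R]_d) : R :=
  sup [set enorm (x - y) | x in A & y in A].

Definition probs_on (E : set 'rV[R]_d) : set (probability 'rV[R]_d R) :=
  [set mu | mu E = 1%E].

End Euclidean.

(* k-dimensional Lebesgue measure, as the k-fold product of the Lebesgue
   measure on the line: the recursion is the definition (by sections) of the
   product measure, read through the bijection R * R^k ~ R^(k+1). *)
Fixpoint lebesgue_vol (R : realType) (k : nat) : set 'rV[R]_k -> \bar R :=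
  match k with
  | 0%N => fun A => \d_(0 : 'rV[R]_0) A
  | k'.+1 => fun A => (\int[@lebesgue_measure R]_(t in setT)
      lebesgue_vol [set y : 'rV[R]_k' | A (row_mx (t%:M : 'rV[R]_1) y)])%E
  end.

Definition unit_ball_vol (R : realType) (k : nat) : R :=
  fine (lebesgue_vol (eball (0 : 'rV[R]_k) 1)).

Definition const_c (R : realType) (d : nat) : R :=
  4 / 3 * (6 ^+ d * d%:R ^+ 2 * (d%:R + 1) * unit_ball_vol R d
           / unit_ball_vol R d.-1).

(* On products of copies of R^d the product sigma-algebra carried by T1 * T2 is
   the Borel one, R^d being second countable. *)
Section Couplings.
Context {d1 d2 : measure_display} {T1 : measurableType d1}
  {T2 : measurableType d2} {R : realType}.

Definition couplings (rho : probability T1 R) (mu : probability T2 R)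
    : set (probability (T1 * T2)%type R) :=
  [set gamma |
    (forall A, measurable A -> pushforward gamma fst A = rho A) /\
    (forall B, measurable B -> pushforward gamma snd B = mu B)].

End Couplings.

Section Transport.
Variables (R : realType) (d : nat).
Implicit Types (rho mu : probability 'rV[R]_d R)
  (gamma : probability ('rV[R]_d * 'rV[R]_d)%type R).
Local Open Scope ereal_scope.

Definition quadratic_cost gamma : \bar R :=
  \int[gamma]_(z in setT) ((enorm (z.1 - z.2)%R) ^+ 2)%:E.

Definition optimal_plans rho mu
    : set (probability ('rV[R]_d * 'rV[R]_d)%type R) :=
  [set gamma | couplings rho mu gamma /\
    forall gamma', couplings rho mu gamma' ->
      quadratic_cost gamma <= quadratic_cost gamma'].

Definition wasserstein (r : \bar R) rho mu : \bar R :=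
  ereal_inf [set Lnorm gamma r (fun z => (enorm (z.1 - z.2)%R)%:E)
            | gamma in couplings rho mu].

(* W_q on R^d * R^d with respect to the norm (|x|^q + |y|^q)^(1/q). *)
Definition plan_wasserstein (q : R)
    (gamma0 gamma1 : probability ('rV[R]_d * 'rV[R]_d)%type R) : \bar R :=
  (ereal_inf [set \int[pi]_(z in setT)
                ((enorm (z.1.1 - z.2.1)%R) `^ q
                 + (enorm (z.1.2 - z.2.2)%R) `^ q)%R%:E
             | pi in couplings gamma0 gamma1]) `^ q^-1.

Definition diam_wasserstein (q : R)
    (G : set (probability ('rV[R]_d * 'rV[R]_d)%type R)) : \bar R :=
  ereal_sup [set plan_wasserstein q gamma0 gamma1 | gamma0 in G & gamma1 in G].

End Transport.

(* The case r = -oo is irrelevant, r being at least 1 in use. *)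
Definition exponent_nu (R : realType) (q : R) (r : \bar R) (theta : R) : R :=
  match r with
  | EFin r' => r' * theta / (q * (r' + theta))
  | _ => theta / q
  end.

Definition const_C (R : realType) (d : nat) (q : R) (r : \bar R)
    (X Y : set 'rV[R]_d) (M theta : R) : R :=
  ediam Y
  * (const_c R d * M * ediam X `^ (d%:R - 1 + theta) + 1) `^ q^-1
  * ediam X `^ (- exponent_nu q r theta).

(* Main.v *)
Require Import Defs.
From mathcomp Require Import all_boot all_order all_algebra.
From mathcomp Require Import all_classical all_reals all_analysis measurable_realfun.
From mathcomp Require Import ring lra zify.

Set Implicit Arguments.
Unset Strict Implicit.
Unset Printing Implicit Defensive.

Import Order.TTheory GRing.Theory Num.Theory.
Import numFieldNormedType.Exports.

Local Open Scope classical_set_scope.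
Local Open Scope ring_scope.

(** Why the theorem holds. Two optimal plans [gamma0] and [gamma1] have the same
    first marginal [rho], and they differ only where an optimal plan splits
    mass. Their average is optimal too, so that the targets of a split point [x]
    are subgradients at [x] of one convex function [phi]. If [y0] and [y1] are
    subgradients of [phi] at points within [eta] of [x], and [p] is the gradient
    of [phi], then the mean of [phi] over a ball of radius [r] around [x] exceeds
    a support at [x] by at least a multiple of [t |y1 - y0|], where [t] is of
    order [r], and this excess is at most the mean of [<p x', x' - x>]
    ([ball_flux_ge]). On a line parallel to the [j]-th axis the coordinate [p_j]
    is monotone with total variation at most the diameter of [Y], whence a first
    moment is bounded by increments ([first_moment_le]), and the increments of
    [p_j] over a ball of radius [D + r] are bounded by the number of lines that
    meet it ([ball_incr_le]). So [|y1 - y0|] is bounded by the mass that a fixed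
    measure, concentrated near [X] and of total mass of order
    [D_Y (D + r)^(d - 1) / r^(d - 1)], puts in the ball of radius [r] around [x].
    Integrated against [rhot], this is at most the total mass times
    [sup_z rhot (B_r z) <= M r^(d - 1 + theta)], hence of order [eta^theta] when
    [r] is proportional to [eta].

    The points of [X] that a coupling of [rho] and [rhot] moves by less than
    [eta] are thus controlled by [rhot]; at the others [|y1 - y0|] is at most the
    diameter of [Y]. Altogether [W_q^q] is at most
    [D_Y^q (c (eta / D_X)^theta + sigma {|x - x'| >= eta})] ([main_estimate],
    [flux_constant_le]). Markov's inequality bounds the last term by
    [(W_r / eta)^r], or makes it zero when [r] is infinite and [eta > W_r], and
    [eta = D_X (W_r / D_X)^(r / (r + theta))] balances both terms
    ([plan_distance_le_norm]).

    All of this is carried out with finite sums. The sets [X] and [Y] are cut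
    into small Borel cells; exchanging mass between charged cells cannot lower
    the cost of an optimal plan ([optimal_rearrangement]), so that points chosen
    in these cells are cyclically monotone up to the size of the cells, and
    [phi] is a maximum of finitely many affine functions
    ([optimal_plan_subgradient]). On each cell the two plans are coupled
    independently ([glued_coupling]), which replaces a disintegration. The
    integrals over balls and lines are sums over a lattice of mesh [h], and the
    only asymptotic fact about lattice points that is used is a bound of the
    number of points of a ball in dimension [d - 1] by the number in dimension
    [d] ([nb_ratio]). It comes from slicing and a parabola below
    [(1 - t^2)^(n/2)] ([expr_ge_parabola]); the same parabola bounds the ratio of
    the volumes of the unit balls in the constant of the theorem
    ([unit_ball_vol_ratio]). *)

(** * The Euclidean inner product and norm *)

Section EuclideanNorm.
Context {R : realType} {d : nat}.
Implicit Types x y z v : 'rV[R]_d.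

Definition dot x y : R := \sum_(i < d) x 0 i * y 0 i.

Lemma dotC x y : dot x y = dot y x.
Proof. by apply: eq_bigr => i _; rewrite mulrC. Qed.

Lemma dotDl x y z : dot (x + y) z = dot x z + dot y z.
Proof. by rewrite -big_split; apply: eq_bigr => i _; rewrite mxE mulrDl. Qed.

Lemma dotNl x y : dot (- x) y = - dot x y.
Proof. by rewrite -sumrN; apply: eq_bigr => i _; rewrite mxE mulNr. Qed.

Lemma dotZl a x y : dot (a *: x) y = a * dot x y.
Proof. by rewrite mulr_sumr; apply: eq_bigr => i _; rewrite mxE mulrA. Qed.

Lemma dotDr x y z : dot x (y + z) = dot x y + dot x z.
Proof. by rewrite dotC dotDl !(dotC x). Qed.

Lemma dotNr x y : dot x (- y) = - dot x y.
Proof. by rewrite dotC dotNl dotC. Qed.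

Lemma dotZr a x y : dot x (a *: y) = a * dot x y.
Proof. by rewrite dotC dotZl dotC. Qed.

Lemma dotBl x y z : dot (x - y) z = dot x z - dot y z.
Proof. by rewrite dotDl dotNl. Qed.

Lemma dotBr x y z : dot x (y - z) = dot x y - dot x z.
Proof. by rewrite dotDr dotNr. Qed.

Lemma enormE x : enorm x = Num.sqrt (dot x x).
Proof. by congr Num.sqrt; apply: eq_bigr => i _; rewrite expr2. Qed.

Lemma dot_ge0 x : 0 <= dot x x.
Proof. by apply: sumr_ge0 => i _; rewrite -expr2 sqr_ge0. Qed.

Lemma enorm_ge0 x : 0 <= enorm x.
Proof. exact: sqrtr_ge0. Qed.

Lemma sqr_enorm x : enorm x ^+ 2 = dot x x.
Proof. by rewrite enormE sqr_sqrtr // dot_ge0. Qed.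

Lemma enormN x : enorm (- x) = enorm x.
Proof. by rewrite !enormE dotNl dotNr opprK. Qed.

Lemma enormB x y : enorm (x - y) = enorm (y - x).
Proof. by rewrite -enormN opprB. Qed.

Lemma enormZ a x : enorm (a *: x) = `|a| * enorm x.
Proof.
by rewrite !enormE dotZl dotZr mulrA -expr2 sqrtrM ?sqr_ge0 // sqrtr_sqr.
Qed.

Lemma enorm0 : enorm (0 : 'rV[R]_d) = 0.
Proof. by rewrite -(scale0r 0) enormZ normr0 mul0r. Qed.

Lemma coord_le_enorm x i : `|x 0 i| <= enorm x.
Proof.
rewrite -sqrtr_sqr ler_wsqrtr // (bigD1 i) //= lerDl.
by apply: sumr_ge0 => k _; exact: sqr_ge0.
Qed.

Lemma enorm_eq0 x : enorm x = 0 -> x = 0.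
Proof.
move=> x0; apply/rowP => i; apply/eqP; rewrite mxE -normr_le0 -x0.
exact: coord_le_enorm.
Qed.

(** Cauchy-Schwarz, from the nonnegativity of the squared norm of
    [|y|^2 x - <x, y> y]. *)
Lemma dot_le_enorm x y : dot x y <= enorm x * enorm y.
Proof.
have [y0|y0] := eqVneq y 0.
  by rewrite y0 enorm0 mulr0 /dot big1 // => i _; rewrite mxE mulr0.
have yy : 0 < dot y y.
  rewrite lt_neqAle dot_ge0 andbT eq_sym; apply: contra_neq y0 => yy.
  by apply: enorm_eq0; rewrite enormE yy sqrtr0.
have := dot_ge0 (dot y y *: x - dot x y *: y).
rewrite !(dotBl, dotBr, dotZl, dotZr) (dotC y x) => H.
have {}H : 0 <= dot y y * (dot x x * dot y y - dot x y ^+ 2).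
  by apply: le_trans H _; rewrite le_eqVlt; apply/orP; left; apply/eqP; ring.
have {}H : dot x y ^+ 2 <= (enorm x * enorm y) ^+ 2.
  by rewrite exprMn !sqr_enorm -subr_ge0 -(pmulr_rge0 _ yy).
rewrite (le_trans (ler_norm _)) // -(@ler_pXn2r _ 2%N) ?nnegrE //.
- by rewrite real_normK // num_real.
- by rewrite mulr_ge0 // enorm_ge0.
Qed.

Lemma enormD x y : enorm (x + y) <= enorm x + enorm y.
Proof.
rewrite -(@ler_pXn2r _ 2%N) ?nnegrE ?addr_ge0 ?enorm_ge0 //.
rewrite sqrrD !sqr_enorm !(dotDl, dotDr) (dotC y x).
by have := dot_le_enorm x y; lra.
Qed.

Lemma enormD3 x y z : enorm (x - z) <= enorm (x - y) + enorm (y - z).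
Proof. by rewrite -[x - z](subrKA y) enormD. Qed.

(** The crude constant [d] in place of the optimal [sqrt d] is enough to control
    the distance to a fine lattice. *)
Lemma enorm_le_coord x (c : R) :
  (forall i, `|x 0 i| <= c) -> enorm x <= d%:R * c.
Proof.
move=> xc; have [i0|d0] := pickP 'I_d; last first.
  have : d = 0%N by case: (d) d0 => // n /(_ ord0).
  move=> d0'; rewrite /enorm big1 ?sqrtr0 ?d0' ?mul0r // => i.
  by have := d0 i.
have c0 : 0 <= c by exact: le_trans (normr_ge0 _) (xc i0).
rewrite -(@ler_pXn2r _ 2%N) ?nnegrE ?enorm_ge0 ?mulr_ge0 //.
rewrite sqr_enorm (@le_trans _ _ (\sum_(i < d) c ^+ 2)) //.
  apply: ler_sum => i _; rewrite -expr2 -real_normK ?num_real //.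
  by rewrite lerXn2r ?nnegrE.
rewrite sumr_const card_ord -[leLHS]mulr_natl exprMn ler_wpM2r ?sqr_ge0 //.
by rewrite -natrX ler_nat expnS expn1 leq_pmull // (leq_ltn_trans _ (ltn_ord i0)).
Qed.

Lemma unit_direction v : exists e : 'rV[R]_d, enorm e <= 1 /\ dot v e = enorm v.
Proof.
have [v0|v0] := eqVneq (enorm v) 0.
  exists 0; rewrite enorm0 v0 ler01; split=> //.
  by rewrite /dot big1 // => i _; rewrite mxE mulr0.
exists ((enorm v)^-1 *: v); rewrite enormZ dotZr -sqr_enorm.
rewrite ger0_norm ?invr_ge0 ?enorm_ge0 // mulVf // lexx.
by rewrite expr2 mulrA mulVf // mul1r.
Qed.

End EuclideanNorm.

(** * Counting the lattice points of a ball *)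

Section SumsOverLists.
Context {R : realType}.

Lemma ler_sum_inj (S T : eqType) (s : seq S) (t : seq T) (f : S -> T)
    (F : T -> R) :
  uniq s -> uniq t -> {in s &, injective f} -> {in s, forall x, f x \in t} ->
  {in t, forall y, 0 <= F y} ->
  \sum_(x <- s) F (f x) <= \sum_(y <- t) F y.
Proof.
move=> us ut finj fst F0; rewrite -(big_map f xpredT F).
rewrite (perm_big [seq y <- t | y \in map f s]) /=; last first.
  apply: uniq_perm; rewrite ?filter_uniq ?map_inj_in_uniq //.
  move=> y; rewrite mem_filter; apply/idP/andP => [ys|[]//]; split=> //.
  by case/mapP: ys => x xs ->; exact: fst.
rewrite big_filter [leRHS](bigID (mem (map f s))) /=.
rewrite lerDl big_seq_cond; apply: sumr_ge0 => y /andP[yt _]; exact: F0.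
Qed.

Lemma sum_bij (S T : eqType) (s : seq S) (t : seq T) (f : S -> T) (F : T -> R) :
  uniq s -> uniq t -> {in s &, injective f} -> map f s =i t ->
  \sum_(x <- s) F (f x) = \sum_(y <- t) F y.
Proof.
move=> us ut finj fst; rewrite -(big_map f xpredT F); apply: perm_big.
by apply: uniq_perm; rewrite ?map_inj_in_uniq.
Qed.

End SumsOverLists.

Section Lattice.
Context {R : realType}.

Definition latv d (z : 'rV[int]_d) : 'rV[R]_d := map_mx intr z.

Lemma latvE d (z : 'rV[int]_d) i : latv z 0 i = (z 0 i)%:~R.
Proof. by rewrite mxE. Qed.

Lemma latvD d (z w : 'rV[int]_d) : latv (z + w) = latv z + latv w.
Proof. by apply/rowP => i; rewrite !mxE intrD. Qed.

Lemma latvN d (z : 'rV[int]_d) : latv (- z) = - latv z.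
Proof. by apply/rowP => i; rewrite !mxE intrN. Qed.

Lemma latvB d (z w : 'rV[int]_d) : latv (z - w) = latv z - latv w.
Proof. by rewrite latvD latvN. Qed.

Definition boxZ d (m : nat) : seq 'rV[int]_d :=
  [seq \row_i (Posz (f i) - Posz m) | f : {ffun 'I_d -> 'I_(2 * m).+1}].

Lemma boxZ_uniq d m : uniq (boxZ d m).
Proof.
apply/injectiveP => f g /rowP fg; apply/ffunP => i; apply: val_inj.
by have := fg i; rewrite !mxE => /addIr[].
Qed.

Lemma mem_boxZ d m (z : 'rV[int]_d) :
  (forall i, `|z 0 i| <= m%:Z) -> z \in boxZ d m.
Proof.
move=> zm; apply/mapP.
exists [ffun i => inord (absz (z 0 i + m%:Z))]; first by rewrite mem_enum.
apply/rowP => i; rewrite !mxE ffunE; move: (z 0 i) (zm i) => k km.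
rewrite inordK; lia.
Qed.

Definition ballZ d (r : R) : seq 'rV[int]_d :=
  [seq z <- boxZ d (Num.truncn r) | enorm (latv z) <= r].

Lemma ballZ_uniq d r : uniq (ballZ d r).
Proof. by rewrite filter_uniq // boxZ_uniq. Qed.

Lemma mem_ballZ d r (z : 'rV[int]_d) : (z \in ballZ d r) = (enorm (latv z) <= r).
Proof.
rewrite mem_filter; apply/andP/idP => [[]//|zr]; split=> //.
have r0 : 0 <= r := le_trans (enorm_ge0 _) zr.
apply: mem_boxZ => i; have := le_trans (coord_le_enorm (latv z) i) zr.
rewrite latvE -intr_norm -abszE -[_%:~R]/((absz _)%:R) -truncn_ge_nat //.
Qed.

Lemma sum_ballZN d r (F : 'rV[int]_d -> R) :
  \sum_(z <- ballZ d r) F (- z) = \sum_(z <- ballZ d r) F z.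
Proof.
apply: sum_bij; rewrite ?ballZ_uniq //; first by move=> x y _ _ /oppr_inj.
move=> z; apply/mapP/idP => [[x]|zr]; last exists (- z); rewrite ?opprK //.
  by rewrite !mem_ballZ => xr ->; rewrite latvN enormN.
by rewrite mem_ballZ latvN enormN -mem_ballZ.
Qed.

(** As [k] varies this runs through a line parallel to the [j]-th axis. *)
Definition insr (T : Type) d (j : 'I_d.+1) (k : T) (z : 'rV[T]_d) : 'rV[T]_d.+1 :=
  \row_i if unlift j i is Some i' then z 0 i' else k.

Lemma insr_eq T d (j : 'I_d.+1) (k : T) z : insr j k z 0 j = k.
Proof. by rewrite mxE unlift_none. Qed.

Lemma insr_lift T d (j : 'I_d.+1) (k : T) z i : insr j k z 0 (lift j i) = z 0 i.
Proof. by rewrite mxE liftK. Qed.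

Lemma insrK T d (j : 'I_d.+1) (z : 'rV[T]_d.+1) : insr j (z 0 j) (col' j z) = z.
Proof.
apply/rowP => i; rewrite mxE; case: unliftP => [i' ->|->] //.
by rewrite mxE.
Qed.

Lemma insr_inj T d (j : 'I_d.+1) (k k' : T) z z' :
  insr j k z = insr j k' z' -> k = k' /\ z = z'.
Proof.
move=> /rowP e; split; first by have := e j; rewrite !insr_eq.
by apply/rowP => i; have := e (lift j i); rewrite !insr_lift.
Qed.

Lemma sqr_enorm_insr d (j : 'I_d.+1) k (z : 'rV[int]_d) :
  enorm (latv (insr j k z)) ^+ 2 = k%:~R ^+ 2 + enorm (latv z) ^+ 2.
Proof.
rewrite !sqr_enorm /dot (@bigD1_ord _ _ _ _ j) //= !mxE unlift_none expr2; congr (_ + _).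
by apply: eq_bigr => i _; rewrite !mxE liftK.
Qed.

Definition nb d (r : R) := size (ballZ d r).

Lemma nbE d r : (nb d r)%:R = \sum_(z <- ballZ d r) (1 : R).
Proof. by rewrite big_const_seq count_predT iter_addr addr0. Qed.

Lemma nb_gt0 d r : 0 <= r -> (0 < nb d r)%N.
Proof.
move=> r0; rewrite -has_predT; apply/hasP; exists 0 => //.
by rewrite mem_ballZ (_ : latv 0 = 0) ?enorm0 //; apply/rowP => i; rewrite !mxE.
Qed.

Lemma block_index_inj (N : nat) (a b : int) (f g : 'I_N) :
  Posz N * a + Posz f = Posz N * b + Posz g -> a = b /\ f = g.
Proof.
have := ltn_ord f; have := ltn_ord g => gN fN E.
have ab : a = b.
  apply/eqP; rewrite eq_le; apply/andP; split; rewrite leNgt; apply/negP => l.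
    have := ler_wpM2l (_ : 0 <= N%:Z) (_ : b + 1 <= a); nia.
  have := ler_wpM2l (_ : 0 <= N%:Z) (_ : a + 1 <= b); nia.
by split=> //; apply: val_inj; move: E; rewrite ab /=; lia.
Qed.

(** [Z^k] is the disjoint union of the blocks [N z + [0,N)^k]; comparing a ball
    with the blocks that meet it, or lie in it, gives this estimate and
    [nb_scale_down]. *)
Lemma nb_scale_up k N (r : R) :
  (N ^ k * nb k r <= nb k (N%:R * (r + k%:R)))%N.
Proof.
have -> : (N ^ k * nb k r = size [seq (z, f) | z <- ballZ k r, f <- enum {ffun 'I_k -> 'I_N}])%N.
  by rewrite size_allpairs -cardE card_ffun !card_ord mulnC.
rewrite -(size_map (fun p : 'rV[int]_k * {ffun 'I_k -> 'I_N} =>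
  \row_i (Posz N * p.1 0 i + Posz (p.2 i)))).
apply: uniq_leq_size.
  rewrite map_inj_in_uniq ?allpairs_uniq ?ballZ_uniq ?enum_uniq //.
    by move=> [? ?] [? ?] _ _ [-> ->].
  move=> [z f] [w g] _ _ /rowP /= e; congr pair.
    by apply/rowP => i; have := e i; rewrite !mxE => /block_index_inj[].
  by apply/ffunP => i; have := e i; rewrite !mxE => /block_index_inj[].
move=> w /mapP[[z f] /allpairsP[[z' f'] [/= zr _ [-> ->]]] ->].
move: zr; rewrite !mem_ballZ /= => zr.
rewrite (_ : latv _ = N%:R *: latv z' + \row_i ((f' i : nat)%:R)); last first.
  by apply/rowP => i; rewrite !mxE intrD intrM.
rewrite (le_trans (enormD _ _)) // mulrDr enormZ ger0_norm // lerD //.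
  by rewrite ler_wpM2l.
rewrite mulrC; apply: enorm_le_coord => i; rewrite mxE ger0_norm // ler_nat.
exact/ltnW/ltn_ord.
Qed.

Lemma nb_scale_down k N (r : R) : (0 < N)%N ->
  (nb k (N%:R * (r - k%:R)) <= N ^ k * nb k r)%N.
Proof.
case: N => // N _.
have -> : (N.+1 ^ k * nb k r =
    size [seq (z, f) | z <- ballZ k r, f <- enum {ffun 'I_k -> 'I_N.+1}])%N.
  by rewrite size_allpairs -cardE card_ffun !card_ord mulnC.
pose dv (x : int) := (x %/ N.+1%:Z)%Z.
pose md (x : int) := (x %% N.+1%:Z)%Z.
have xE x : x = dv x * N.+1%:Z + md x by exact: divz_eq.
have md0 x : 0 <= md x by exact: modz_ge0.
have mdN x : md x < N.+1%:Z by exact: ltz_pmod.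
have modN x : (absz (md x) < N.+1)%N.
  by have := md0 x; have := mdN x; move: (md x) => y; lia.
rewrite /nb -(size_map (fun z : 'rV[int]_k => (\row_i dv (z 0 i),
  [ffun i => inord (absz (md (z 0 i)))] : {ffun 'I_k -> 'I_N.+1}))).
apply: uniq_leq_size.
  rewrite map_inj_in_uniq ?ballZ_uniq //.
  move=> z w _ _ [/rowP e1 /ffunP e2]; apply/rowP => i.
  have := e1 i; have /(congr1 val) := e2 i; rewrite !mxE !ffunE /= !inordK //.
  move=> E1 E2; rewrite (xE (z 0 i)) (xE (w 0 i)) E2; congr (_ + _); move: E1.
  by have := md0 (z 0 i); have := md0 (w 0 i); move: (md _) (md _) => x y; lia.
move=> _ /mapP[z zr ->]; apply/allpairsP; eexists (_, _).
split; [|by rewrite mem_enum|by []].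
move: zr; rewrite !mem_ballZ /= => zr.
have -> : latv (\row_i dv (z 0 i)) = N.+1%:R^-1 *: latv z
    - \row_i (N.+1%:R^-1 * (md (z 0 i))%:~R) :> 'rV[R]_k.
  apply/rowP => i; rewrite !mxE -mulrBr -intrB.
  have -> : z 0 i - md (z 0 i) = dv (z 0 i) * N.+1%:Z.
    by rewrite {1}(xE (z 0 i)) addrK.
  by rewrite mulrC intrM mulfK // pnatr_eq0.
rewrite (le_trans (enormD _ _)) // enormN enormZ ger0_norm ?invr_ge0 //.
rewrite -[leRHS](subrK k%:R) lerD //.
  by rewrite ler_pdivrMl // (le_trans zr).
rewrite -[leRHS]mulr1; apply: enorm_le_coord => i.
rewrite mxE ger0_norm; last by rewrite mulr_ge0 ?invr_ge0 // ler0z.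
rewrite ler_pdivrMl // mulr1 -[_%:R]/(N.+1%:Z%:~R) ler_int.
by rewrite ltW.
Qed.

(** Homogeneity of the number of lattice points in a ball, up to a bounded
    change of the radii: the balls are dilated by integers [p] and [q] that make
    them comparable. The integer [q] exceeds [r1 + k], so that rounding [p] to
    an integer costs at most [1] in the radius [r2]. *)
Lemma nb_compare k (r1 r2 : R) : (0 < k)%N -> 0 <= r1 -> k%:R + 1 <= r2 ->
  (nb k r1)%:R * (r2 - k%:R - 1) ^+ k <= (nb k r2)%:R * (r1 + k%:R) ^+ k.
Proof.
move=> k0 r10 r2k; have r1k : 0 < r1 + k%:R by rewrite ltr_wpDl // ltr0n.
pose q := (Num.truncn (r1 + k%:R)).+1.
have q1 : r1 + k%:R <= q%:R by apply/ltW; rewrite truncnS_gt.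
have q0 : 0 < q%:R :> R by rewrite ltr0n.
pose x := q%:R * (r2 - k%:R) / (r1 + k%:R).
have x0 : 0 <= x by rewrite divr_ge0 ?mulr_ge0 // ?(ltW r1k) //; lra.
pose p := Num.truncn x.
have /andP[px xp] := truncn_itv x0; rewrite -/p in px xp.
have up : p%:R * (r1 + k%:R) <= q%:R * (r2 - k%:R).
  by rewrite -ler_pdivlMr.
have low : q%:R * (r2 - k%:R - 1) <= p%:R * (r1 + k%:R).
  move: xp; rewrite ltr_pdivrMr // -natr1 mulrDl mul1r => xp.
  by move: q1 xp; set y := q%:R; set w := p%:R; rewrite !(mulrBr, mulr1); lra.
have sub : (nb k (p%:R * (r1 + k%:R)) <= nb k (q%:R * (r2 - k%:R)))%N.
  apply: uniq_leq_size; rewrite ?ballZ_uniq // => z.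
  by rewrite !mem_ballZ => /le_trans; apply.
have : (p ^ k * nb k r1 <= q ^ k * nb k r2)%N.
  by rewrite (leq_trans (nb_scale_up _ _ _)) // (leq_trans sub) // nb_scale_down.
rewrite -(ler_nat R) !natrM !natrX => H.
rewrite -(@ler_pM2l _ (q%:R ^+ k)) ?exprn_gt0 //.
rewrite mulrCA -exprMn (@le_trans _ _ ((nb k r1)%:R * (p%:R * (r1 + k%:R)) ^+ k)) //.
  rewrite ler_wpM2l // lerXn2r // ?nnegrE ?mulr_ge0 ?(ltW r1k) //; lra.
rewrite exprMn !mulrA ler_wpM2r ?exprn_ge0 ?(ltW r1k) //.
by rewrite mulrC.
Qed.

End Lattice.

(** * Lattice points of balls in consecutive dimensions *)

Section BallRatio.
Context {R : realType}.

(** A lower bound of the integral of [(1 - t^2)^(n/2)] over [[-1, 1]], that is of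
    the ratio of the volumes of the unit balls of dimensions [n + 1] and [n]: it
    is the integral of the positive part of the parabola of
    [expr_ge_parabola]. *)
Definition ball_ratio (n : nat) : R := 4 / (3 * Num.sqrt ((n%:R + 2) / 2)).

Lemma ball_ratio_gt0 k : 0 < ball_ratio k :> R.
Proof. by rewrite /ball_ratio divr_gt0 // mulr_gt0 // sqrtr_gt0 divr_gt0 // ltr_wpDl. Qed.

(** Bernoulli's inequality for the power [n/2] of [a^2], with the slope [n/2]
    increased to [(n + 2)/2]: with the slope [n/2] it fails for [n = 1], where
    the power is concave. *)
Lemma expr_ge_parabola n (a : R) : 0 <= a <= 1 ->
  1 - (n%:R + 2) / 2 * (1 - a ^+ 2) <= a ^+ n.
Proof.
move=> /andP[a0 a1]; have a2 : a ^+ 2 <= 1 by rewrite expr_le1.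
have [k ->] : exists k, n = (odd n + k.*2)%N by exists n./2; rewrite odd_double_half.
elim: k => [|k IH].
  by rewrite double0 addn0; case: (odd n) => /=; rewrite ?expr0 ?expr1; nra.
rewrite doubleS !addnS -addn2 natrD exprD.
have := ler_wpM2r (sqr_ge0 a) IH.
have : 0 <= (odd n + k.*2)%:R :> R by [].
move: (a ^+ (_ + _)) ((_ + _)%:R) (a ^+ 2) a2 => A B c c1 B0 H.
have := mulr_ge0 B0 (sqr_ge0 (1 - c)); nra.
Qed.

Lemma expr_sub_ge n (a c : R) : 0 <= c -> c <= a -> a <= 1 ->
  a ^+ n - n%:R * c <= (a - c) ^+ n.
Proof.
move=> c0 ca a1; elim: n => [|n IH]; first by rewrite !expr0 mul0r subr0.
rewrite !exprS -natr1 mulrDl mul1r.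
have ac : 0 <= a - c by rewrite subr_ge0.
apply: le_trans (ler_wpM2l ac IH).
have an : a ^+ n <= 1 by rewrite exprn_ile1 //; lra.
have an0 : 0 <= a ^+ n by rewrite exprn_ge0 //; lra.
have nn : 0 <= n%:R * c :> R by rewrite mulr_ge0.
have h1 : 0 <= n%:R * c * (1 - a) by rewrite mulr_ge0 ?subr_ge0.
have h2 : 0 <= c * (1 - a ^+ n) by rewrite mulr_ge0 ?subr_ge0.
have h3 : 0 <= n%:R * c * c by rewrite mulr_ge0.
move: h1 h2 h3; rewrite !(mulrBr, mulrBl, mulrDl, mulrA, mulr1); lra.
Qed.

Lemma sum_sqr_centered K :
  \sum_(i < (2 * K).+1) (i%:R - K%:R : R) ^+ 2
  = K%:R * (K%:R + 1) * (2 * K%:R + 1) / 3.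
Proof.
have gen n x : \sum_(i < n) (i%:R - x : R) ^+ 2
    = n%:R * x ^+ 2 - x * n%:R * (n%:R - 1)
      + n%:R * (n%:R - 1) * (2 * n%:R - 1) / 6.
  elim: n => [|n IH]; first by rewrite big_ord0; field.
  by rewrite big_ord_recr /= IH -natr1; field.
by rewrite gen -natr1 natrM; field.
Qed.

Lemma ler_sqr_norm (u s : R) : - s <= u <= s -> u ^+ 2 <= s ^+ 2.
Proof. by move=> /andP[? ?]; nra. Qed.

Lemma nb_slices d K (s : R) : K%:R <= s ->
  (\sum_(i < (2 * K).+1) nb d (Num.sqrt (s ^+ 2 - (i%:R - K%:R) ^+ 2))
     <= nb d.+1 s)%N.
Proof.
move=> Ks; have s0 : 0 <= s := le_trans (ler0n _ _) Ks.
pose r (i : 'I_(2 * K).+1) := Num.sqrt (s ^+ 2 - (i%:R - K%:R) ^+ 2).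
have -> : (\sum_(i < (2 * K).+1) nb d (r i)
    = size [seq (i, z) | i <- index_enum 'I_(2 * K).+1, z <- ballZ d (r i)])%N.
  rewrite size_allpairs_dep sumnE big_map.
  by apply: eq_big.
rewrite -(size_map (fun p : 'I_(2 * K).+1 * 'rV[int]_d =>
  insr ord0 (Posz p.1 - Posz K) p.2)).
apply: uniq_leq_size.
  rewrite map_inj_in_uniq.
    apply: allpairs_uniq_dep => [|i _|].
    - exact: index_enum_uniq.
    - exact: ballZ_uniq.
    - by move=> [? ?] [? ?] _ _ /= [-> ->].
  move=> [i z] [j w] _ _ e; have [/addIr[ij] zw] := insr_inj e.
  by congr pair => //; apply: val_inj.
move=> w /mapP[[i z] /allpairsPdep[i' [z' [_ + [-> ->]]]] ->].
rewrite !mem_ballZ /= => zr.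
rewrite -(@ler_pXn2r _ 2%N) ?nnegrE ?enorm_ge0 // sqr_enorm_insr intrB.
have iK : (i'%:R - K%:R) ^+ 2 <= s ^+ 2 :> R.
  have : (i' <= 2 * K)%N by rewrite -ltnS.
  rewrite -(ler_nat R) natrM => iK.
  have i0 : 0 <= i'%:R :> R by [].
  by apply: ler_sqr_norm; apply/andP; split; lra.
have : enorm (latv z') ^+ 2 <= r i' ^+ 2.
  by rewrite lerXn2r // nnegrE ?enorm_ge0 ?sqrtr_ge0.
rewrite [r i' ^+ 2]sqr_sqrtr ?subr_ge0 // => H.
by rewrite -lerBrDl.
Qed.

(** The ball of dimension [n + 1] is sliced by hyperplanes; each slice is
    compared with the [n]-dimensional ball of radius [r], and the numbers of
    points of the slices add up to the integral that [ball_ratio] bounds. *)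
Lemma nb_ratio n : (0 < n)%N -> exists C s0 : R, forall s r : R,
  s0 <= s -> 0 < s -> 0 <= r ->
  (nb n r)%:R * s ^+ n * (ball_ratio n * s - C)
    <= (nb n.+1 s)%:R * (r + n%:R) ^+ n.
Proof.
move=> n0; exists (3 + 3 * n%:R * (n%:R + 1)), (2 * (n%:R + 2)) => s r ss0 s0 r0.
set m : R := (n%:R + 2) / 2.
have n1 : 1 <= n%:R :> R by rewrite ler1n.
have m32 : 3 / 2 <= m by rewrite /m; lra.
pose q := Num.sqrt m.
have qq : q ^+ 2 = m by rewrite sqr_sqrtr //; lra.
have q1 : 1 <= q by rewrite -sqrtr1 ler_wsqrtr //; lra.
pose x := s / q.
have x1 : 1 <= x.
  rewrite ler_pdivlMr ?mul1r; last lra.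
  by have : q <= q ^+ 2 by [nra]; rewrite qq /m; lra.
have xs : x <= s by rewrite ler_pdivrMr; nra.
have xE : ball_ratio n * s = 4 * x / 3.
  by rewrite /ball_ratio -/m -/q /x; field; lra.
have m_s : m / s ^+ 2 = x ^- 2.
  by rewrite /x -qq; field; apply/andP; split; lra.
pose K := Num.truncn x.
have /andP[Kx xK] : K%:R <= x < K.+1%:R by apply: truncn_itv; lra.
have K0 : 0 <= K%:R :> R by [].
pose rr (i : 'I_(2 * K).+1) := Num.sqrt (s ^+ 2 - (i%:R - K%:R) ^+ 2).
have slice (i : 'I_(2 * K).+1) :
  (nb n r)%:R * s ^+ n *
    (1 - (i%:R - K%:R) ^+ 2 / x ^+ 2 - n%:R * (n%:R + 1) / s)
  <= (nb n (rr i))%:R * (r + n%:R) ^+ n.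
  set u : R := i%:R - K%:R.
  have uK : u ^+ 2 <= x ^+ 2.
    have : (i <= 2 * K)%N by rewrite -ltnS.
    rewrite -(ler_nat R) natrM => iK.
    have i0 : 0 <= i%:R :> R by [].
    by apply: ler_sqr_norm; apply/andP; split; rewrite /u; lra.
  pose a := Num.sqrt (1 - u ^+ 2 / s ^+ 2).
  have us : u ^+ 2 / s ^+ 2 <= 2 / 3.
    rewrite ler_pdivrMr ?exprn_gt0 //.
    apply: le_trans uK _; rewrite /x expr_div_n qq ler_pdivrMr; last lra.
    have := sqr_ge0 s; nra.
  have us0 : 0 <= u ^+ 2 / s ^+ 2 by rewrite divr_ge0 ?sqr_ge0.
  have a2 : a ^+ 2 = 1 - u ^+ 2 / s ^+ 2 by rewrite sqr_sqrtr //; lra.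
  have a0 : 0 <= a by exact: sqrtr_ge0.
  have a1 : a <= 1 by rewrite -sqrtr1 ler_wsqrtr //; lra.
  have a12 : 1 / 2 <= a by nra.
  have rE : rr i = s * a.
    rewrite -[s]ger0_norm ?(ltW s0) // -sqrtr_sqr -sqrtrM ?sqr_ge0 //.
    by congr Num.sqrt; rewrite mulrBr mulr1 mulrCA divff ?mulr1 // expf_neq0 // gt_eqF.
  have sa : n%:R + 1 <= rr i by rewrite rE; nra.
  apply: le_trans (nb_compare n0 r0 sa).
  rewrite -mulrA ler_wpM2l // rE.
  set c := (n%:R + 1) / s.
  have -> : s * a - n%:R - 1 = s * (a - c) by rewrite /c; field; lra.
  have ca : c <= a by rewrite ler_pdivrMr // mulrC; rewrite rE in sa; lra.
  have c0 : 0 <= c by rewrite divr_ge0 //; lra.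
  rewrite [leRHS]exprMn ler_wpM2l ?exprn_ge0 ?(ltW s0) //.
  apply: le_trans (expr_sub_ge n c0 ca a1).
  rewrite -mulrA -/c lerD2r.
  apply: le_trans (expr_ge_parabola n _); last by rewrite a0 a1.
  by rewrite -/m a2 subKr mulrCA m_s.
have := ler_sum (index_enum _) (fun i (_ : true) => slice i).
rewrite -mulr_sumr -mulr_suml -natr_sum => H.
have sub : (\sum_(i < (2 * K).+1) nb n (rr i) <= nb n.+1 s)%N.
  by apply: nb_slices; lra.
apply: le_trans (_ : _ <= (\sum_(i < (2 * K).+1) nb n (rr i))%:R * (r + n%:R) ^+ n) _; last first.
  by rewrite ler_wpM2r ?ler_nat // exprn_ge0 // addr_ge0.
apply: le_trans H; rewrite ler_wpM2l ?mulr_ge0 ?exprn_ge0 ?(ltW s0) //.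
rewrite sumrB sumrB !sumr_const !card_ord -mulr_suml sum_sqr_centered xE.
have nE : (2 * K).+1%:R = 2 * K%:R + 1 :> R by rewrite -addn1 natrD natrM.
rewrite -[X in _ <= _ - X]mulr_natl nE.
move: xK; rewrite -natr1; set k : R := K%:R in K0 Kx * => xK.
have step1 : k * (k + 1) * (2 * k + 1) / 3 / x ^+ 2 <= 2 * x / 3 + 4 / 3.
  have x0 : 0 < x by lra.
  rewrite ler_pdivrMr ?exprn_gt0 //.
  have : k * (k + 1) * (2 * k + 1) <= x * (x + 1) * (2 * x + 1).
    rewrite ler_pM ?ler_pM //; nra.
  nra.
have step2 : (2 * k + 1) * (n%:R * (n%:R + 1) / s) <= 3 * n%:R * (n%:R + 1).
  have k3 : (2 * k + 1) / s <= 3 by rewrite ler_pdivrMr //; lra.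
  have w0 : 0 <= n%:R * (n%:R + 1) :> R by rewrite mulr_ge0 //; lra.
  by have := ler_wpM2r w0 k3; rewrite !mulrA [_ / s * _]mulrAC (mulrAC _ s^-1).
lra.
Qed.

End BallRatio.

(** * Sums along the lines of the lattice *)

Section Lines.
Context {R : realType}.

Lemma sum_centered_recr (G : int -> R) m :
  \sum_(i < (2 * m.+1).+1) G (Posz i - Posz m.+1)
  = \sum_(i < (2 * m).+1) G (Posz i - Posz m)
    + (G (- Posz m.+1) + G (Posz m.+1)).
Proof.
have -> : ((2 * m.+1).+1 = (2 * m).+3)%N by lia.
rewrite big_ord_recl big_ord_recr /= [RHS]addrCA; congr (G _ + (_ + G _)).
- by lia.
- by apply: eq_bigr => i _; congr G; rewrite /bump /=; lia.
- by rewrite /bump /=; lia.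
Qed.

Lemma sum_increments (g : int -> R) m :
  \sum_(i < (2 * m).+1) (g (Posz i - Posz m) - g (Posz i - Posz m - 1))
    = g (Posz m) - g (- Posz m - 1).
Proof.
elim: m => [|m IH]; first by rewrite big_ord_recl big_ord0 addr0.
rewrite (sum_centered_recr (fun k => g k - g (k - 1))) IH.
have -> : - Posz m - 1 = - Posz m.+1 by lia.
have -> : Posz m.+1 - 1 = Posz m by lia.
by ring.
Qed.

(** The terms of indices [k] and [- k] add up to [k (g k - g (- k))], at most [k]
    times the total increment, and [1 + ... + m = m (m + 1) / 2]. The bound [N]
    on [m] will be common to all chords of a ball. *)
Lemma first_moment_le (g : int -> R) N m : (m <= N)%N ->
  (forall k, g (k - 1) <= g k) ->
  \sum_(i < (2 * m).+1) (Posz i - Posz m)%:~R * g (Posz i - Posz m)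
  <= (N%:R * (N%:R + 1) / 2) * \sum_(i < (2 * m).+1)
       (g (Posz i - Posz m) - g (Posz i - Posz m - 1)).
Proof.
move=> mN gmono.
rewrite sum_increments.
have H : \sum_(i < (2 * m).+1) (Posz i - Posz m)%:~R * g (Posz i - Posz m)
    <= (m%:R * (m%:R + 1) / 2) * (g (Posz m) - g (- Posz m)).
  elim: m {mN} => [|m IH].
    by rewrite big_ord_recl big_ord0 addr0 !mul0r.
  rewrite (sum_centered_recr (fun k => k%:~R * g k)).
  have g1 : g (- Posz m.+1) <= g (- Posz m).
    by have := gmono (- Posz m); have -> : - Posz m - 1 = - Posz m.+1 by lia.
  have g2 : g (Posz m) <= g (Posz m.+1).
    by have := gmono (Posz m.+1); have -> : Posz m.+1 - 1 = Posz m by lia.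
  have m0 : 0 <= m%:R :> R by [].
  rewrite intrN -[(Posz m.+1)%:~R]/(m.+1%:R : R) -natr1.
  set a := g (- Posz m.+1) in g1 *; set e := g (Posz m.+1) in g2 *.
  set c := g (- Posz m) in g1 IH; set b := g (Posz m) in g2 IH.
  set q : R := m%:R in m0 IH *.
  have w0 : 0 <= q * (q + 1) / 2 by nra.
  have h1 : 0 <= (q * (q + 1) / 2) * (c - a) by rewrite mulr_ge0 ?subr_ge0.
  have h2 : 0 <= (q * (q + 1) / 2) * (e - b) by rewrite mulr_ge0 ?subr_ge0.
  nra.
have mono_pos k : g (- Posz k) <= g (Posz k).
  elim: k => [|k IH] //.
  have := gmono (- Posz k); have -> : - Posz k - 1 = - Posz k.+1 by lia.
  have := gmono (Posz k.+1); have -> : Posz k.+1 - 1 = Posz k by lia.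
  lra.
apply: le_trans H _; have m0 : 0 <= m%:R :> R by [].
have mN' : m%:R <= N%:R :> R by rewrite ler_nat.
have gm := gmono (- Posz m).
apply: ler_pM; rewrite ?subr_ge0 //; nra.
Qed.

Lemma ler_sqrE (x y : R) : 0 <= x -> 0 <= y -> (x <= y) = (x ^+ 2 <= y ^+ 2).
Proof. by move=> x0 y0; rewrite ler_pXn2r. Qed.

Definition half_chord d (r : R) (z : 'rV[int]_d) : nat :=
  Num.truncn (Num.sqrt (r ^+ 2 - enorm (latv z : 'rV[R]_d) ^+ 2)).

Lemma half_chord_le d r (z : 'rV[int]_d) : 0 <= r ->
  (half_chord r z <= Num.truncn r)%N.
Proof.
move=> r0; rewrite le_truncn // -[leRHS]ger0_norm // -sqrtr_sqr ler_wsqrtr //.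
by rewrite gerBl sqr_ge0.
Qed.

(** A line parallel to the [j]-th axis meets the ball in an interval centered at
    the coordinate hyperplane. *)
Lemma sum_ballZ_chords d (j : 'I_d.+1) (r : R) (F : 'rV[int]_d.+1 -> R) : 0 <= r ->
  \sum_(w <- ballZ d.+1 r) F w
  = \sum_(z <- ballZ d r) \sum_(i < (2 * half_chord r z).+1)
      F (insr j (Posz i - Posz (half_chord r z)) z).
Proof.
move=> r0.
pose m (z : 'rV[int]_d) := half_chord r z.
rewrite -(@big_allpairs_dep _ _ _ _ (fun z => 'I_(2 * m z).+1) _
  (fun z i => insr j (Posz i - Posz (m z)) z) _ (fun z => index_enum _)).
apply: perm_big; apply: uniq_perm; first exact: ballZ_uniq.
  apply: allpairs_uniq_dep => [|z _|]; first exact: ballZ_uniq.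
    exact: index_enum_uniq.
  move=> [z i] [z' i'] _ _ /= e; have [ii zz] := insr_inj e.
  by clear e; subst z'; move: ii => /addIr[] /val_inj ->.
have chord (z : 'rV[int]_d) (k : int) : enorm (latv z : 'rV[R]_d) <= r ->
    (enorm (latv (insr j k z) : 'rV[R]_d.+1) <= r) = (`|k|%N <= m z)%N.
  move=> zr; rewrite truncn_ge_nat ?sqrtr_ge0 //.
  rewrite (ler_sqrE (enorm_ge0 _) r0) sqr_enorm_insr.
  rewrite [RHS](ler_sqrE (ler0n _ _) (sqrtr_ge0 _)).
  have h : 0 <= r ^+ 2 - enorm (latv z : 'rV[R]_d) ^+ 2.
    by rewrite subr_ge0 -ler_sqrE ?enorm_ge0.
  rewrite (sqr_sqrtr h).
  rewrite lerBrDr; congr (_ + _ <= _).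
  by rewrite -[_%:R]/((Posz `|k|)%:~R) abszE intr_norm real_normK // num_real.
move=> w; apply/idP/allpairsPdep => [wr|[z [i [zr _ ->]]]].
  have zr : enorm (latv (col' j w) : 'rV[R]_d) <= r.
    move: wr; rewrite mem_ballZ; apply: le_trans.
    rewrite -(@ler_pXn2r _ 2%N) ?nnegrE ?enorm_ge0 //.
    by rewrite -[w in leRHS](insrK j) sqr_enorm_insr lerDr sqr_ge0.
  move: wr; rewrite mem_ballZ -{1}(insrK j w) chord // => km.
  have kI : (absz (w ord0 j + Posz (m (col' j w)))%R < (2 * m (col' j w)).+1)%N.
    by move: km; move: (w ord0 j : int) => k; lia.
  exists (col' j w), (Ordinal kI); rewrite mem_ballZ mem_index_enum.
  split=> //=; rewrite -{1}(insrK j w); congr (insr j _ _).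
  by move: km; move: (w ord0 j : int) => k /=; lia.
move: zr; rewrite !mem_ballZ => zr; rewrite chord //.
by have := ltn_ord i; lia.
Qed.

Definition incr d (j : 'I_d) (f : 'rV[int]_d -> R) w := f w - f (w - delta_mx 0 j).

Lemma insr_pred d (j : 'I_d.+1) k (z : 'rV[int]_d) :
  insr j k z - delta_mx 0 j = insr j (k - 1) z.
Proof.
apply/rowP => i; rewrite !mxE /=; case: unliftP => [i' ->|->].
  by rewrite eq_sym (negbTE (neq_lift _ _)) subr0.
by rewrite eqxx.
Qed.

Lemma ball_moment_le d (j : 'I_d.+1) (r : R) c (f : 'rV[int]_d.+1 -> R) :
  0 <= r -> (forall w, f (w - delta_mx 0 j) <= f w) ->
  \sum_(w <- ballZ d.+1 r) (w 0 j)%:~R * f (c + w)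
  <= (Num.truncn r)%:R * ((Num.truncn r)%:R + 1) / 2
     * \sum_(w <- ballZ d.+1 r) incr j f (c + w).
Proof.
move=> r0 fmono; rewrite !(sum_ballZ_chords j) // mulr_sumr.
apply: ler_sum => z _.
pose g k := f (c + insr j k z).
under eq_bigr do rewrite insr_eq -/(g _).
under [in leRHS]eq_bigr do rewrite /incr -addrA insr_pred -/(g _) -/(g _).
apply: first_moment_le; first exact: half_chord_le.
by move=> k; rewrite /g -insr_pred addrA.
Qed.

(** The increments telescope on each chord, and the chords are indexed by a ball
    in one dimension fewer: this is where the exponent [d - 1] comes from. *)
Lemma ball_incr_le d (j : 'I_d.+1) (r D : R) c (f : 'rV[int]_d.+1 -> R) :
  0 <= r -> (forall w w', f w - f w' <= D) ->
  \sum_(w <- ballZ d.+1 r) incr j f (c + w) <= (nb d r)%:R * D.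
Proof.
move=> r0 fD; rewrite (sum_ballZ_chords j) // nbE mulr_suml.
apply: ler_sum => z _; rewrite mul1r.
pose g k := f (c + insr j k z).
under eq_bigr do rewrite /incr -addrA insr_pred -/(g _) -/(g _).
by rewrite sum_increments fD.
Qed.

End Lines.

(** * Distant subgradients make the mean of a convex function grow *)

Section Subgradients.
Context {R : realType} {d : nat}.
Implicit Types (phi : 'rV[R]_d -> R) (p : 'rV[R]_d -> 'rV[R]_d).

Definition subgradient phi p :=
  forall x x', phi x + dot (p x) (x' - x) <= phi x'.

Lemma subgradient_monotone phi p x x' : subgradient phi p ->
  0 <= dot (p x - p x') (x - x').
Proof.
move=> sg; have := sg x x'; have := sg x' x.
by rewrite !dotBr !dotBl; lra.
Qed.

Lemma subgradient_affine phi p c : subgradient phi p ->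
  subgradient (fun x => phi x - phi c - dot (p c) (x - c)) (fun x => p x - p c).
Proof.
by move=> sg x x'; have := sg x x'; rewrite !(dotBr, dotBl); lra.
Qed.

Lemma sum_ballZ_odd (r : R) (F : 'rV[int]_d -> R) :
  (forall z, F (- z) = - F z) ->
  \sum_(z <- ballZ d r) F z = 0.
Proof.
move=> Fodd; have := @sum_ballZN R d r F.
under eq_bigr do rewrite Fodd.
rewrite sumrN; lra.
Qed.

(** Jensen's inequality: the ball is symmetric, so that the linear part of the
    support of [phi] at [b] has mean zero. *)
Lemma jensen_ballZ phi p b h (r : R) : subgradient phi p ->
  (nb d r)%:R * phi b <= \sum_(z <- ballZ d r) phi (b + h *: latv z).
Proof.
move=> sg; apply: (@le_trans _ _
    (\sum_(z <- ballZ d r) (phi b + dot (p b) (h *: latv z)))).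
  rewrite big_split /= [X in _ <= _ + X]sum_ballZ_odd ?addr0; last first.
    by move=> z; rewrite latvN scalerN dotNr.
  by rewrite nbE mulr_suml; under [leRHS]eq_bigr do rewrite -[phi b]mul1r.
by apply: ler_sum => z _; have := sg b (b + h *: latv z); rewrite [b + _]addrC addrK.
Qed.

Lemma lattice_approx (u : 'rV[R]_d) (h : R) : 0 < h ->
  exists w : 'rV[int]_d, enorm (u - h *: latv w) <= d%:R * h.
Proof.
move=> h0; exists (\row_i Num.floor (u 0 i / h)); apply: enorm_le_coord => i.
rewrite !mxE; have /andP[] := floor_itv (u 0 i / h).
move: (Num.floor _) => k; rewrite intrD ler_pdivlMr // ltr_pdivrMr // => h1 h2.
by rewrite ler_norml; apply/andP; split; nra.
Qed.

(** Moving away from [a1] in the direction [e] of [y1 - y0], and from [a0] in the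
    direction [- e], [phi] grows at least as its two affine minorants; hence
    [psi], its excess over a support at [c], is at least [t |y1 - y0| / 2 - eps]
    at one of these points. By Jensen's inequality it has at least this mean
    over the ball of radius [s] around that point, up to the distance [kappa]
    of the point to the lattice, and this ball lies in the ball of radius [r]
    around [c]. There the sum of [psi] is at most the sum of [<p x, x - c>], by
    convexity again. *)
Lemma ball_flux_ge phi p (DY eps h kappa eta t s r : R) (c a0 a1 y0 y1 : 'rV[R]_d) :
  subgradient phi p -> (forall x x', enorm (p x - p x') <= DY) ->
  0 < h -> d%:R * h <= kappa -> 0 <= t ->
  (forall x, phi a0 + dot y0 (x - a0) - eps <= phi x) ->
  (forall x, phi a1 + dot y1 (x - a1) - eps <= phi x) ->
  enorm (a0 - c) <= eta -> enorm (a1 - c) <= eta -> eta + t + kappa + s <= r ->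
  (nb d (s / h))%:R * (t / 2 * enorm (y1 - y0) - eps - DY * kappa)
    <= \sum_(z <- ballZ d (r / h)) dot (p (c + h *: latv z)) (h *: latv z).
Proof.
move=> sg pD h0 hk t0 sub0 sub1 a0c a1c etar.
pose psi x := phi x - phi c - dot (p c) (x - c).
have psisg := subgradient_affine c sg; rewrite -/psi in psisg.
have psi0 x : 0 <= psi x by have := sg c x; rewrite /psi; lra.
have DY0 : 0 <= DY := le_trans (enorm_ge0 _) (pD 0 0).
have [e [e1 ye]] := unit_direction (y1 - y0).
pose b1 := a1 + t *: e; pose b0 := a0 - t *: e.
have near_c b a : enorm (a - c) <= eta -> enorm (b - a) <= t ->
    enorm (b - c) <= eta + t.
  by move=> ac ba; have := enormD3 b a c; lra.
have te : enorm (t *: e) <= t by rewrite enormZ ger0_norm //; nra.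
have b1c : enorm (b1 - c) <= eta + t.
  by apply: near_c a1c _; rewrite /b1 [a1 + _]addrC addrK.
have b0c : enorm (b0 - c) <= eta + t.
  by apply: near_c a0c _; rewrite /b0 [a0 - _]addrC addrK enormN.
have psib : t * enorm (y1 - y0) - 2 * eps <= psi b1 + psi b0.
  have := sub1 b1; have := sub0 b0; have := psi0 a1; have := psi0 a0.
  rewrite /psi /b1 /b0 -ye.
  by rewrite !(dotDr, dotNr, dotDl, dotNl, dotZr) !opprD !(mulrBr, mulrDr); lra.
have [b [bc pb]] : exists b, enorm (b - c) <= eta + t /\
    t / 2 * enorm (y1 - y0) - eps <= psi b.
  have [l|l] := lerP (psi b1) (psi b0); [exists b0|exists b1]; split=> //; lra.
have [w bw] := lattice_approx (b - c) h0.
pose b' := c + h *: latv w.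
have bb' : enorm (b - b') <= kappa by rewrite /b' opprD addrA (le_trans bw).
have pb' : psi b - DY * kappa <= psi b'.
  have := psisg b b'; have := dot_le_enorm (p b - p c) (b - b').
  rewrite -[b' - b]opprB dotNr.
  have : enorm (p b - p c) * enorm (b - b') <= DY * kappa.
    by apply: ler_pM; rewrite ?enorm_ge0.
  by lra.
apply: (@le_trans _ _ (\sum_(z <- ballZ d (r / h)) psi (c + h *: latv z))).
  apply: (@le_trans _ _ (\sum_(z <- ballZ d (s / h)) psi (c + h *: latv (w + z)))).
    apply: (@le_trans _ _ ((nb d (s / h))%:R * psi b')).
      by rewrite ler_wpM2l //; lra.
    under eq_bigr do rewrite latvD scalerDr addrA.
    exact: (jensen_ballZ _ _ _ psisg).
  apply: (ler_sum_inj (F := fun z => psi (c + h *: latv z))) => //.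
  - exact: ballZ_uniq.
  - exact: ballZ_uniq.
  - by move=> x y _ _ /addrI.
  move=> z; rewrite !mem_ballZ !ler_pdivlMr // => zs.
  have hw : enorm (latv w : 'rV[R]_d) * h <= eta + t + kappa.
    have : enorm (h *: latv w : 'rV[R]_d) <= enorm (b - c) + enorm (b - b').
      have -> : h *: latv w = (b - c) - (b - b').
        by rewrite opprB addrC addrA subrK /b' [c + _]addrC addrK.
      by rewrite -(enormN (b - b')) enormD.
    by rewrite enormZ gtr0_norm //; lra.
  rewrite latvD.
  have := enormD (latv w : 'rV[R]_d) (latv z).
  by rewrite -(ler_pM2r h0) mulrDl; lra.
rewrite [leLHS](_ : _ = \sum_(z <- ballZ d (r / h)) (phi (c + h *: latv z) - phi c)).
  apply: ler_sum => z _; have := sg (c + h *: latv z) c.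
  by rewrite opprD addNKr dotNr; lra.
rewrite /psi sumrB [X in _ - X = _]sum_ballZ_odd ?subr0 // => z.
by rewrite latvN scalerN ![c + _]addrC !addrK dotNr.
Qed.

End Subgradients.

(** * A majorant of the oscillation of the subgradients *)

Section Majorant.
Context {R : realType} {n : nat}.
Local Notation d := n.+1.

(** The sums of [<p x', x' - x>] that [ball_flux_ge] produces are bounded,
    coordinate by coordinate, by the increments of [p_j] over the ball around
    [x] ([ball_moment_le]). All these balls lie in the ball of radius [D + r]
    around [x0]: each lattice point of the latter carries as weight its
    increments of the [p_j], and a point [x] sees the weights at distance less
    than [r]. The total weight is bounded by [ball_incr_le]. The terms [d h]
    absorb the rounding of [x0] and [x] to the lattice. *)
Lemma flux_majorant_mesh (phi : 'rV[R]_d -> R) (p : 'rV[R]_d -> 'rV[R]_d)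
    (x0 : 'rV[R]_d) (D r s t eta DY h : R) (c0 : 'rV[int]_d) :
  subgradient phi p -> (forall x x', enorm (p x - p x') <= DY) ->
  0 < h -> enorm (x0 - h *: latv c0) <= d%:R * h ->
  0 <= t -> 0 <= s -> 0 <= eta -> eta + t + s + 4 * (d%:R * h) < r ->
  exists2 l : seq (R * 'rV[R]_d),
    (forall u, u \in l -> 0 <= u.1) /\
    \sum_(u <- l) u.1 <= r * (r + h) / (2 * h) * d%:R * (nb n ((D + r) / h))%:R * DY
  & forall eps x y0 y1 a0 a1, enorm (x - x0) <= D ->
      (forall z, phi a0 + dot y0 (z - a0) - eps <= phi z) ->
      (forall z, phi a1 + dot y1 (z - a1) - eps <= phi z) ->
      enorm (a0 - x) <= eta -> enorm (a1 - x) <= eta ->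
      (nb d (s / h))%:R * (t / 2 * enorm (y1 - y0) - eps - DY * (d%:R * h))
      <= \sum_(u <- l) u.1 * (enorm (x - u.2) < r)%R%:R.
Proof.
move=> sg pD h0 c0x t0 s0 eta0 etar.
set kap := d%:R * h in c0x etar *; have kap0 : 0 < kap by rewrite mulr_gt0.
have DY0 : 0 <= DY := le_trans (enorm_ge0 _) (pD 0 0).
pose r' := r - 2 * kap.
have r'0 : 0 <= r' by rewrite /r'; lra.
have r'h0 : 0 <= r' / h by rewrite divr_ge0 // ltW.
pose N : R := (Num.truncn (r' / h))%:R.
have Nr : N * h <= r by rewrite -ler_pdivlMr // (le_trans (_ : _ <= r' / h)) // ?truncn_le // ler_pM2r ?invr_gt0 // /r'; lra.
have N0 : 0 <= N by rewrite /N.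
pose f j (w : 'rV[int]_d) := p (h *: latv w) 0 j.
have fmono j w : f j (w - delta_mx 0 j) <= f j w.
  have := subgradient_monotone (h *: latv w) (h *: latv (w - delta_mx 0 j)) sg.
  rewrite -scalerBr -latvB subKr dotZr pmulr_rge0 // /dot (bigD1 j) //= big1.
    by rewrite !mxE !eqxx mulr1 addr0 subr_ge0.
  by move=> i ij; rewrite !mxE eqxx (negbTE ij) mulr0.
have J0 j w : 0 <= incr j (f j) w by rewrite subr_ge0.
have fD j w w' : f j w - f j w' <= DY.
  rewrite (le_trans _ (pD (h *: latv w) (h *: latv w'))) //.
  by rewrite (le_trans _ (coord_le_enorm _ j)) // !mxE ler_norm.
pose A := h * (N * (N + 1) / 2).
have A0 : 0 <= A by rewrite /A !mulr_ge0 ?(ltW h0) ?invr_ge0 ?addr_ge0.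
pose B := ballZ d ((D + r) / h).
exists [seq (A * incr j (f j) (c0 + w), h *: latv (c0 + w)) | j <- index_enum 'I_d, w <- B].
  split=> [u /allpairsP[[j w] [_ _ ->]]|]; first by rewrite mulr_ge0.
  rewrite big_allpairs_dep /=.
  have [rD|rD] := ltP ((D + r) / h) 0.
    have -> : B = [::].
      have : forall w, w \notin B.
        by move=> w; rewrite mem_ballZ -ltNge (lt_le_trans rD) ?enorm_ge0.
      by case: (B) => // w B' /(_ w); rewrite mem_head.
    rewrite big1; last by move=> j _; rewrite big_nil.
    by rewrite !mulr_ge0 ?invr_ge0 ?mulr_ge0 //; lra.
  have line j : \sum_(w <- B) A * incr j (f j) (c0 + w) <= A * ((nb n ((D + r) / h))%:R * DY).
    by rewrite -mulr_sumr ler_wpM2l // ball_incr_le.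
  apply: le_trans (ler_sum _ (fun j _ => line j)) _.
  rewrite sumr_const card_ord -[leLHS]mulr_natl.
  rewrite [leLHS](_ : _ = A * (d%:R * (nb n ((D + r) / h))%:R * DY)); last by ring.
  rewrite -[leRHS]mulrA -[leRHS]mulrA [leRHS](_ : _ = r * (r + h) / (2 * h) * (d%:R * (nb n ((D + r) / h))%:R * DY)); last by rewrite !mulrA.
  rewrite ler_wpM2r ?mulr_ge0 // ler_pdivlMr ?mulr_gt0 // /A.
  have : (N * h) * (N * h + h) <= r * (r + h).
    by apply: ler_pM; rewrite ?addr_ge0 ?mulr_ge0 ?(ltW h0) // lerD2r.
  by congr (_ <= _); field.
move=> eps x y0 y1 a0 a1 xx0 sub0 sub1 a0x a1x.
have [c cx] := lattice_approx x h0; rewrite -/kap in cx.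
have near_c a : enorm (a - x) <= eta -> enorm (a - h *: latv c) <= eta + kap.
  by move=> ax; have := enormD3 a x (h *: latv c); lra.
have sumr' : (eta + kap) + t + kap + s <= r' by rewrite /r'; lra.
apply: le_trans (ball_flux_ge sg pD h0 (lexx _) t0 sub0 sub1 (near_c _ a0x) (near_c _ a1x) sumr') _.
rewrite big_allpairs_dep /=.
rewrite [leLHS](_ : _ = \sum_j h * \sum_(z <- ballZ d (r' / h)) (z 0 j)%:~R * f j (c + z)); last first.
  rewrite /dot exchange_big; apply: eq_bigr => j _; rewrite mulr_sumr.
  apply: eq_bigr => z _; rewrite /f latvD scalerDr !mxE; ring.
apply: ler_sum => j _.
apply: le_trans (ler_wpM2l (ltW h0) (ball_moment_le c r'h0 (fmono j))) _.
rewrite mulrA -/A mulr_sumr.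
pose F w := A * incr j (f j) (c0 + w) * (enorm (x - h *: latv (c0 + w)) < r)%R%:R.
have F0 w : 0 <= F w by rewrite /F mulr_ge0 ?ler0n // mulr_ge0.
apply: (@le_trans _ _ (\sum_(z <- ballZ d (r' / h)) F (c - c0 + z))); last first.
  apply: (ler_sum_inj (F := F)); rewrite ?ballZ_uniq //; first by move=> z z' _ _ /addrI.
  move=> z; rewrite !mem_ballZ !ler_pdivlMr // => zr.
  rewrite latvD.
  have cc0 : enorm (latv (c - c0) : 'rV[R]_d) * h <= D + 2 * kap.
    have -> : enorm (latv (c - c0) : 'rV[R]_d) * h = enorm (h *: latv c - h *: latv c0).
      by rewrite latvB -scalerBr enormZ gtr0_norm // mulrC.
    have := enormD3 (h *: latv c) x (h *: latv c0).
    have := enormD3 x x0 (h *: latv c0).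
    by rewrite (enormB _ x); lra.
  have := enormD (latv (c - c0) : 'rV[R]_d) (latv z).
  by rewrite -(ler_pM2r h0) mulrDl; rewrite /r' in zr; lra.
rewrite big_seq_cond [leRHS]big_seq_cond; apply: ler_sum => z; rewrite mem_ballZ ler_pdivlMr // => /andP[zr _].
have -> : F (c - c0 + z) = A * incr j (f j) (c + z)
    * (enorm (x - h *: latv (c + z)) < r)%R%:R.
  by rewrite /F addrA [c0 + _]addrC subrK.
have -> : enorm (x - h *: latv (c + z)) < r.
  rewrite latvD scalerDr opprD addrA (le_lt_trans (enormD _ _)) // enormN enormZ.
  by rewrite gtr0_norm // mulrC; rewrite /r' in zr; lra.
by rewrite mulr1.
Qed.

(** The function of [h] is, up to a factor, the bound that [flux_majorant_mesh]
    and [nb_ratio] give on the total weight divided by the number of points of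
    a ball of radius [s / h]. *)
Lemma mesh_limit (D r s C I0 : R) (m : nat) : 0 < s -> 0 < I0 ->
  (fun h => r * (r + h) * (D + r + m%:R * h) ^+ n / (s ^+ n * (I0 * s - C * h)))
    @ (0 : R) --> r * r * (D + r) ^+ n / (s ^+ n * (I0 * s)).
Proof.
move=> s0 I00.
have lin a b : (fun h : R => a + b * h) @ (0 : R) --> a.
  rewrite -[X in _ --> X]addr0 -[X in _ --> _ + X](mulr0 b).
  by apply: cvgD; [exact: cvg_cst|apply: cvgMr; exact: cvg_id].
apply: cvgM.
  apply: cvgM; last first.
    elim: n => [|k IH]; first exact: cvg_cst.
    by under eq_fun do rewrite exprS; rewrite exprS; apply: cvgM => //; exact: lin.
  apply: cvgMr; have := lin r 1.
  by under eq_fun do rewrite mul1r.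
apply: cvgV; first by rewrite gt_eqF // !mulr_gt0 // exprn_gt0.
apply: cvgMr; have := lin (I0 * s) (- C).
by under eq_fun do rewrite mulNr.
Qed.

(** The estimate of [flux_majorant_mesh] is divided by the number of lattice points
    of a ball, for a mesh so small that the discretization costs at most
    [e]. *)
Lemma flux_majorant (phi : 'rV[R]_d -> R) (p : 'rV[R]_d -> 'rV[R]_d)
    (x0 : 'rV[R]_d) (D r s t eta DY e : R) :
  (0 < n)%N -> subgradient phi p -> (forall x x', enorm (p x - p x') <= DY) ->
  0 <= D -> 0 < t -> 0 < s -> 0 <= eta -> eta + t + s < r -> 0 < e ->
  exists2 l : seq (R * 'rV[R]_d),
    (forall u, u \in l -> 0 <= u.1) /\
    \sum_(u <- l) u.1
      <= d%:R * DY / t * (r * r * (D + r) ^+ n / (s ^+ n * (ball_ratio n * s))) + e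
  & forall eps x y0 y1 a0 a1, enorm (x - x0) <= D ->
      (forall z, phi a0 + dot y0 (z - a0) - eps <= phi z) ->
      (forall z, phi a1 + dot y1 (z - a1) - eps <= phi z) ->
      enorm (a0 - x) <= eta -> enorm (a1 - x) <= eta ->
      enorm (y1 - y0)
      <= 2 / t * eps + e + \sum_(u <- l) u.1 * (enorm (x - u.2) < r)%R%:R.
Proof.
move=> n0 sg pD D0 t0 s0 eta0 etar e0.
have DY0 : 0 <= DY := le_trans (enorm_ge0 _) (pD 0 0).
have [C [sig ratio]] := @nb_ratio R n n0.
have I0 : 0 < ball_ratio n :> R := ball_ratio_gt0 n.
pose G h := r * (r + h) * (D + r + n%:R * h) ^+ n
  / (s ^+ n * (ball_ratio n * s - C * h)).
pose a := d%:R * DY / t.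
have a0 : 0 <= a by rewrite /a divr_ge0 ?mulr_ge0 // ltW.
have [h [[h0 hr hs hC he] hG]] : exists h : R, [/\ 0 < h,
    eta + t + s + 4 * (d%:R * h) < r, sig * h <= s,
    C * h < ball_ratio n * s & 2 / t * (DY * (d%:R * h)) <= e] /\
    (a * G h <= a * (r * r * (D + r) ^+ n / (s ^+ n * (ball_ratio n * s))) + e).
  have lin b c : 0 < c -> \forall h \near (0 : R)^'+, b * h < c.
    move=> c0; have : (fun h : R => b * h) @ (0 : R)^'+ --> b * 0.
      by apply: cvgMr; apply: cvg_at_right_filter; exact: cvg_id.
    by move=> /cvgr_lt; apply; rewrite mulr0.
  near (0 : R)^'+ => h; exists h; split; [split|].
  - by near: h; exact: nbhs_right_gt.
  - have : (4 * d%:R) * h < r - (eta + t + s).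
      by near: h; apply: lin; rewrite subr_gt0.
    by rewrite -mulrA; lra.
  - by apply: ltW; near: h; exact: lin.
  - by near: h; apply: lin; rewrite mulr_gt0.
  - rewrite !mulrA; apply: ltW; near: h; exact: lin.
  - near: h.
    have : (fun h => a * G h) @ (0 : R)^'+
        --> a * (r * r * (D + r) ^+ n / (s ^+ n * (ball_ratio n * s))).
      by apply: cvgMr; apply: cvg_at_right_filter; exact: mesh_limit.
    by move=> /cvgr_le; apply; rewrite ltrDl.
have [c0 c0x] := lattice_approx x0 h0.
have [l [l0 lsum] lP] :=
  @flux_majorant_mesh _ _ x0 D r s t eta DY h c0 sg pD h0 c0x (ltW t0) (ltW s0) eta0 hr.
set N : R := (nb d (s / h))%:R in lP.
have N0 : 0 < N by rewrite ltr0n nb_gt0 // divr_ge0 // ltW.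
pose k := 2 / (t * N).
have k0 : 0 < k by rewrite divr_gt0 // mulr_gt0.
exists [seq (k * u.1, u.2) | u <- l].
  split=> [_ /mapP[u ul ->]|]; first by rewrite mulr_ge0 ?l0 // ltW.
  rewrite big_map /= -mulr_sumr; apply: le_trans hG.
  apply: le_trans (ler_wpM2l (ltW k0) lsum) _.
  have r0 : 0 < r by lra.
  have rho0 : 0 <= (D + r) / h by rewrite divr_ge0 // ltW //; lra.
  have sh : sig <= s / h by rewrite ler_pdivlMr.
  have sh0 : 0 < s / h by rewrite divr_gt0.
  have := ratio _ _ sh sh0 rho0; rewrite -/N; set nn : R := (nb n _)%:R.
  set cc := ball_ratio n * s - C * h.
  have cc0 : 0 < cc by rewrite subr_gt0.
  have -> : ball_ratio n * (s / h) - C = cc / h by rewrite /cc; field; lra.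
  have -> : (D + r) / h + n%:R = (D + r + n%:R * h) / h by field; lra.
  rewrite !expr_div_n => H.
  have {}H : nn / (h * N) <= (D + r + n%:R * h) ^+ n / (s ^+ n * cc).
    rewrite ler_pdivlMr ?mulr_gt0 ?exprn_gt0 //.
    rewrite mulrAC ler_pdivrMr ?mulr_gt0 //.
    have hn : 0 < h ^+ n.+1 by rewrite exprn_gt0.
    have := ler_wpM2r (ltW hn) H; rewrite exprS.
    have hh : h ^+ n != 0 by rewrite expf_neq0 // gt_eqF.
    congr (_ <= _); field; rewrite ?hh ?andbT; lra.
  rewrite [leLHS](_ : _ = a * (r * (r + h) * (nn / (h * N)))); last first.
    by rewrite /k /a; field; apply/and3P; split; lra.
  have -> : G h = r * (r + h) * ((D + r + n%:R * h) ^+ n / (s ^+ n * cc)).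
    by rewrite /G -/cc mulrA.
  by rewrite ler_wpM2l // ler_wpM2l // mulr_ge0 //; lra.
move=> eps x y0 y1 a0' a1' xx0 sub0 sub1 ax0 ax1.
have := lP eps x y0 y1 a0' a1' xx0 sub0 sub1 ax0 ax1.
rewrite big_map /= [X in _ -> _ <= _ + X](eq_bigr (fun u => k * (u.1 * (enorm (x - u.2) < r)%R%:R))); last first.
  by move=> u _; rewrite mulrA.
rewrite -mulr_sumr; set S := \sum_(_ <- _) _ => H.
have {}H := ler_wpM2l (ltW k0) H.
have E : k * (N * (t / 2 * enorm (y1 - y0) - eps - DY * (d%:R * h)))
    = enorm (y1 - y0) - 2 / t * eps - 2 / t * (DY * (d%:R * h)).
  by rewrite /k; field; apply/andP; split; lra.
by rewrite E in H; lra.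
Unshelve. all: end_near. Qed.

End Majorant.

(** * Convex potentials from cyclic monotonicity *)

Section Potentials.
Context {R : realType}.

(** Rockafellar's construction: the potential at [j] is the supremum of the sums
    of [w] along the paths from [i0] to [j]. Closing such a path by the step from
    [j] to [i0] bounds its sum. *)
Lemma potential_of_cycles (I : Type) (i0 : I) (w : I -> I -> R) :
  (forall i p, \sum_(e <- zip (i :: p) (rcons p i)) w e.1 e.2 <= 0) ->
  exists h : I -> R, forall i j, h i + w i j <= h j.
Proof.
move=> cyc.
pose ps p j := \sum_(e <- zip (i0 :: p) (rcons p j)) w e.1 e.2.
have psr p j k : ps (rcons p j) k = ps p j + w j k.
  rewrite /ps -rcons_cons zip_rcons ?size_rcons //.
  by rewrite -cats1 big_cat big_seq1.
have psub p j : ps p j <= - w j i0.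
  by have := cyc i0 (rcons p j); rewrite -/(ps _ _) psr; lra.
exists (fun j => sup [set ps p j | p in setT]) => i j.
rewrite -lerBrDr; apply: ge_sup; first by exists (ps [::] i); exists [::].
move=> _ [p _ <-]; rewrite lerBrDr -psr.
apply: ub_le_sup; last by exists (rcons p i).
by exists (- w j i0) => _ [q _ <-]; exact: psub.
Qed.

(** The function [phi] is the maximum of the affine functions of slopes [y i] that
    take the values [H i] at [a i]; the slope of an active one is a
    subgradient. *)
Lemma subgradient_of_potential (d : nat) (I : finType) (i0 : I)
    (a y : I -> 'rV[R]_d) (H : I -> R) (eps : R) :
  (forall i j, H i + dot (y i) (a j - a i) - eps <= H j) ->
  exists phi p, [/\ subgradient phi p, (forall x, exists i, p x = y i) &
    forall i z, phi (a i) + dot (y i) (z - a i) - eps <= phi z].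
Proof.
move=> pot; pose aff i x := H i + dot (y i) (x - a i).
pose sel x := [arg max_(i > i0) aff i x]%O.
have selP x i : aff i x <= aff (sel x) x.
  by rewrite /sel; case: arg_maxP => // k _; exact.
exists (fun x => aff (sel x) x), (fun x => y (sel x)); split.
- move=> x x'; apply: le_trans (selP x' (sel x)).
  by rewrite /aff !dotBr; lra.
- by move=> x; exists (sel x).
- move=> i z; apply: le_trans (selP z i).
  by have := pot (sel (a i)) i; rewrite /aff; lra.
Qed.

End Potentials.

(** * Mixtures of probabilities and conditioning on cells *)

Section Mixtures.
Context {dT : measure_display} {T : measurableType dT} {R : realType}.
Local Open Scope ereal_scope.

Lemma measure_mix (I : Type) (r : seq I) (c : I -> R) (P : I -> probability T R) :
  (forall i, (0 <= c i)%R) -> exists mu : {measure set T -> \bar R},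
    (forall A, mu A = \sum_(i <- r) (c i)%:E * P i A) /\
    (forall f : T -> \bar R, measurable_fun setT f -> (forall x, 0 <= f x) ->
       \int[mu]_x f x = \sum_(i <- r) (c i)%:E * \int[P i]_x f x).
Proof.
move=> c0; elim: r => [|i r [mu [muE muI]]].
  exists mzero; split=> [A|f mf f0]; rewrite big_nil //.
  by rewrite integral_measure_zero.
exists (measure_add (mscale (NngNum (c0 i)) (P i)) mu); split=> [A|f mf f0].
  by rewrite [LHS]measure_addE big_cons muE.
by rewrite ge0_integral_measure_add // ge0_integral_mscale // big_cons muI.
Qed.

Lemma probability_mix (I : Type) (r : seq I) (c : I -> R) (P : I -> probability T R) :
  (forall i, (0 <= c i)%R) -> (\sum_(i <- r) c i = 1)%R ->
  exists Q : probability T R,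
    (forall A, Q A = \sum_(i <- r) (c i)%:E * P i A) /\
    (forall f : T -> \bar R, measurable_fun setT f -> (forall x, 0 <= f x) ->
       \int[Q]_x f x = \sum_(i <- r) (c i)%:E * \int[P i]_x f x).
Proof.
move=> c0 c1; have [mu [muE muI]] := measure_mix r P c0.
have muT : mu setT = 1.
  rewrite muE -[1]/(1%R%:E) -c1 -sumEFin; apply: eq_bigr => i _.
  by rewrite probability_setT mule1.
exists (mnormalize mu (dirac point)).
have E A : mnormalize mu (dirac point) A = mu A.
  by rewrite /mnormalize muT onee_eq0 /= invr1 mule1.
split=> [A|f mf f0]; first by rewrite [LHS]E muE.
by rewrite -muI //; apply: eq_measure_integral => A _ _; exact: E.
Qed.

(** The default value [P] makes this a probability even when [A] is null. *)
Definition condp (P : probability T R) (A : set T) (mA : measurable A)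
    : probability T R := mnormalize (mrestr P mA) P.

Lemma condpE (P : probability T R) (A : set T) (mA : measurable A) (B : set T) : measurable B ->
  P A * condp P mA B = P (B `&` A).
Proof.
move=> mB; rewrite /condp /= /mnormalize /= /mrestr setTI.
have Afin : P A \is a fin_num by exact: fin_num_measure.
have -> : (P A == +oo) = false.
  by apply/negbTE; move: Afin; rewrite fin_numE => /andP[].
rewrite orbF; have [A0|A0] := eqVneq (P A) 0.
  rewrite A0 mul0e; apply/esym/eqP; rewrite eq_le measure_ge0 andbT -A0.
  by apply: le_measure; rewrite ?inE //; exact: measurableI.
rewrite muleCA -[X in _ * (X * _)](fineK Afin) -EFinM divff ?mule1 //.
by rewrite fine_eq0.
Qed.

Lemma condp_as (P : probability T R) (A V : set T) (mA : measurable A) : measurable V ->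
  P A != 0 -> P V = 1 -> condp P mA (V `&` A) = 1.
Proof.
move=> mV A0 V1; have mVA : measurable (V `&` A) by exact: measurableI.
have := condpE P mA mVA; rewrite -setIA setIid.
have -> : P (V `&` A) = P A.
  apply/eqP; rewrite eq_le; apply/andP; split.
    by apply: le_measure; rewrite ?inE //; exact: measurableI.
  have VC : P (~` V) = 0 by rewrite probability_setC // V1 subee.
  rewrite -[leRHS]adde0 -VC.
  apply: le_trans (_ : _ <= P ((V `&` A) `|` ~` V)) _.
    apply: le_measure; rewrite ?inE //.
      by apply: measurableU => //; exact: measurableC.
    by move=> x Ax; have [Vx|Vx] := pselect (V x); [left|right].
  by apply: measureU2 => //; exact: measurableC.
have Afin : P A \is a fin_num by exact: fin_num_measure.
have Vfin : condp P mA (V `&` A) \is a fin_num by exact: fin_num_measure.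
rewrite -(fineK Afin) -(fineK Vfin) -EFinM => -[] H.
congr EFin; apply: (@mulfI _ (fine (P A))); first by rewrite fine_eq0.
by rewrite mulr1.
Qed.

Lemma integral_le_as (P : probability T R) (V : set T) (f : T -> R) (b : R) :
  measurable V -> P V = 1 -> measurable_fun setT f -> (forall x, (0 <= f x)%R) ->
  (0 <= b)%R -> (forall x, V x -> (f x <= b)%R) ->
  \int[P]_x (f x)%:E <= b%:E.
Proof.
move=> mV V1 mf f0 b0 fb; rewrite -[leRHS]mule1 -(probability_setT P).
rewrite -integral_cst //; apply: ae_ge0_le_integral => //.
- by move=> x _; rewrite lee_fin.
- exact/measurable_EFinP.
- have VC : P (~` V) = 0 by rewrite probability_setC // V1 subee.
  exists (~` V); split=> //; first exact: measurableC.
  move=> x /= H Vx; apply: H => _; rewrite lee_fin; exact: fb.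
Qed.

Lemma integral_ge_as (P : probability T R) (V : set T) (f : T -> R) (b : R) :
  measurable V -> P V = 1 -> measurable_fun setT f -> (forall x, (0 <= f x)%R) ->
  (forall x, V x -> (b <= f x)%R) -> b%:E <= \int[P]_x (f x)%:E.
Proof.
move=> mV V1 mf f0 fb; have [b0|b0] := ltP b 0%R.
  by apply: (@le_trans _ _ 0); [rewrite lee_fin ltW|apply: integral_ge0 => x _; rewrite lee_fin].
rewrite -[leLHS]mule1 -(probability_setT P).
rewrite -integral_cst //; apply: ae_ge0_le_integral => //.
- by move=> x _; rewrite lee_fin.
- exact/measurable_EFinP.
- have VC : P (~` V) = 0 by rewrite probability_setC // V1 subee.
  exists (~` V); split=> //; first exact: measurableC.
  move=> x /= H Vx; apply: H => _; rewrite lee_fin; exact: fb.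
Qed.

Lemma probability_setI1 (P : probability T R) (A B : set T) :
  measurable A -> measurable B -> P A = 1 -> P B = 1 -> P (A `&` B) = 1.
Proof.
move=> mA mB A1 B1.
have AC : P (~` A) = 0 by rewrite probability_setC // A1 subee.
have BC : P (~` B) = 0 by rewrite probability_setC // B1 subee.
have mAB : measurable (A `&` B) by exact: measurableI.
have CC : P (~` (A `&` B)) = 0.
  rewrite setCI; apply/eqP; rewrite eq_le measure_ge0 andbT -[leRHS]adde0.
  rewrite -[X in _ <= X + _]AC -BC.
  by apply: measureU2; exact: measurableC.
have := probability_setC P mAB; rewrite CC => /esym/eqP.
by rewrite sube_eq ?add0e ?fin_num_adde_defl // ?fin_num_measure // => /eqP.
Qed.

Lemma probability1_sub (P : probability T R) (A B : set T) :
  measurable A -> measurable B -> A `<=` B -> P A = 1 -> P B = 1.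
Proof.
move=> mA mB AB A1; apply/eqP; rewrite eq_le (probability_le1 P mB) /= -A1.
by apply: le_measure; rewrite ?inE.
Qed.

Section Cells.
Variables (I : finType) (k : T -> I).
Hypothesis mk : forall i, measurable (k @^-1` [set i]).

Definition cellm (P : probability T R) (i : I) : R := fine (P (k @^-1` [set i])).

Lemma cellmE (P : probability T R) i : (cellm P i)%:E = P (k @^-1` [set i]).
Proof. by rewrite fineK // fin_num_measure. Qed.

Lemma cellm_ge0 (P : probability T R) i : (0 <= cellm P i)%R.
Proof. by rewrite -lee_fin cellmE. Qed.

Lemma measurable_cell_pred (p : pred I) : measurable [set x | p (k x)].
Proof.
rewrite (_ : [set x | p (k x)] = \big[setU/set0]_(j <- enum p) (k @^-1` [set j])).
  by apply: bigsetU_measurable.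
rewrite -bigcup_seq; apply/seteqP; split=> [x /= kr|x [j /= + xj]].
  by exists (k x); rewrite //= mem_enum.
by rewrite mem_enum xj.
Qed.

Lemma total_probability (P : probability T R) (A : set T) : measurable A ->
  P A = \sum_(i : I) (cellm P i)%:E * condp P (mk i) A.
Proof.
move=> mA.
under eq_bigr do rewrite cellmE condpE //.
have gen r : uniq r -> P (A `&` [set x | k x \in r])
    = \sum_(i <- r) P (A `&` k @^-1` [set i]).
  elim: r => [_|i r IH /= /andP[ir ur]].
    by rewrite big_nil (_ : _ `&` _ = set0) ?measure0 //; apply/seteqP; split=> x [].
  have mr : measurable (A `&` [set x | k x \in r]).
    by apply: measurableI => //; exact: (measurable_cell_pred (fun j => j \in r)).
  rewrite big_cons -IH // -measureU //; last 2 first.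
  - exact: measurableI.
  - apply/seteqP; split=> // x [[_ xi] [_ kr]].
    by move: ir; have <- : k x = i := xi; rewrite (kr : k x \in r).
  congr (P _); rewrite -setIUr; congr (_ `&` _); apply/seteqP; split=> x /=.
    by rewrite inE => /orP[/eqP|]; [left|right].
  by rewrite inE; case=> [->|->]; rewrite ?eqxx ?orbT.
rewrite -gen ?index_enum_uniq //; congr (P _); apply/seteqP; split=> [x Ax|x []//].
by split=> //=; rewrite mem_index_enum.
Qed.

Lemma cellm_sum (P : probability T R) : (\sum_(i : I) cellm P i = 1)%R.
Proof.
apply: EFin_inj; rewrite -sumEFin -[RHS](probability_setT P).
rewrite (total_probability P measurableT); apply: eq_bigr => i _.
by rewrite probability_setT mule1.
Qed.

Lemma total_expectation (P : probability T R) (f : T -> \bar R) :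
  measurable_fun setT f -> (forall x, 0 <= f x) ->
  \int[P]_x f x = \sum_(i : I) (cellm P i)%:E * \int[condp P (mk i)]_x f x.
Proof.
move=> mf f0.
have [Q [QE QI]] := probability_mix (fun i => condp P (mk i)) (cellm_ge0 P) (cellm_sum P).
rewrite -QI //; apply: eq_measure_integral => A mA _.
by rewrite [RHS]QE -total_probability.
Qed.

Lemma charged_as (P : probability T R) : P [set x | (0 < cellm P (k x))%R] = 1.
Proof.
have mC := measurable_cell_pred (fun i => 0 < cellm P i)%R.
rewrite -[X in P X]setCK probability_setC; last exact: measurableC.
rewrite (_ : P (~` _) = 0) ?sube0 //.
rewrite (total_probability P (measurableC mC)) big1 // => i _.
have [ci|] := ltP 0%R (cellm P i); last first.
  by move=> ci; rewrite (_ : cellm P i = 0%R) ?mul0e //; apply/eqP; rewrite eq_le ci cellm_ge0.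
rewrite cellmE condpE; last exact: measurableC.
rewrite (_ : _ `&` _ = set0) ?measure0 //; apply/seteqP; split=> // x [/= + xi].
by have -> : k x = i := xi.
Qed.

End Cells.
End Mixtures.

(** * Rearrangements of an optimal plan *)

Section Marginals.
Context {d1 d2 : measure_display} {T1 : measurableType d1}
  {T2 : measurableType d2} {R : realType}.
Implicit Types P : probability (T1 * T2)%type R.

Definition fstm P : probability T1 R :=
  distribution P (mfun_Sub (mem_set (@measurable_fst _ _ T1 T2))).

Definition sndm P : probability T2 R :=
  distribution P (mfun_Sub (mem_set (@measurable_snd _ _ T1 T2))).

Lemma measurable_fst_preimage (A : set T1) : measurable A ->
  measurable ((@fst T1 T2) @^-1` A).
Proof. by move=> mA; rewrite -[X in measurable X]setTI; exact: measurable_fst. Qed.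

Lemma measurable_snd_preimage (A : set T2) : measurable A ->
  measurable ((@snd T1 T2) @^-1` A).
Proof. by move=> mA; rewrite -[X in measurable X]setTI; exact: measurable_snd. Qed.

Definition indep (P1 : probability T1 R) (P2 : probability T2 R)
    : probability (T1 * T2)%type R := (P1 \x P2)%E.

Lemma indep_fst (P1 : probability T1 R) (P2 : probability T2 R) A :
  measurable A -> indep P1 P2 (fst @^-1` A) = P1 A.
Proof.
move=> mA; rewrite (_ : fst @^-1` A = A `*` setT); last by rewrite -setXT.
transitivity (P1 A * P2 setT)%E; first exact: product_measure1E.
by rewrite probability_setT mule1.
Qed.

Lemma indep_snd (P1 : probability T1 R) (P2 : probability T2 R) A :
  measurable A -> indep P1 P2 (snd @^-1` A) = P2 A.
Proof.
move=> mA; rewrite (_ : snd @^-1` A = setT `*` A); last by rewrite -setTX.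
transitivity (P1 setT * P2 A)%E; first exact: product_measure1E.
by rewrite probability_setT mul1e.
Qed.

Lemma indep_as (P1 : probability T1 R) (P2 : probability T2 R) A B :
  measurable A -> measurable B ->
  P1 A = 1%E -> P2 B = 1%E -> indep P1 P2 (A `*` B) = 1%E.
Proof.
move=> mA mB A1 B1; transitivity (P1 A * P2 B)%E.
  exact: product_measure1E.
by rewrite A1 B1 mule1.
Qed.

End Marginals.

Section Rearrangement.
Context {d1 d2 : measure_display} {T1 : measurableType d1}
  {T2 : measurableType d2} {R : realType}.
Variables (gamma : probability (T1 * T2)%type R) (c : T1 * T2 -> R).
Hypotheses (mc : measurable_fun setT c) (c0 : forall z, 0 <= c z).
Variables (I : finType) (k : T1 * T2 -> I).
Hypothesis mk : forall i, measurable (k @^-1` [set i]).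

Lemma lower_bound_seq (J : Type) (m : J -> R) (s : seq J) :
  all (fun j => 0 < m j) s -> exists2 a, 0 < a & all (fun j => a <= m j) s.
Proof.
elim: s => [_|j s IH /= /andP[mj /IH[a a0 aP]]]; first by exists 1.
exists (Num.min a (m j)); first by rewrite lt_min a0.
rewrite ge_min lexx orbT /=; apply: sub_all aP => i.
by rewrite ge_min => ->.
Qed.

Local Notation m := (cellm k gamma).
Local Notation cell i := (condp gamma (mk i)).
Local Open Scope ereal_scope.

(** Removing a small multiple of the normalized restriction of the plan to each
    cell [e.1], and adding the same multiple of the product of the first marginal
    of the cell [e.2] and the second marginal of the cell [e.1], preserves the
    marginals when [e.1] and [e.2] run through the same cells; the cost of an
    optimal plan cannot decrease. *)
Lemma optimal_rearrangement (s : seq (I * I)) :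
  (forall gamma' : probability (T1 * T2)%type R,
     (forall A, measurable A -> gamma' (fst @^-1` A) = gamma (fst @^-1` A)) ->
     (forall B, measurable B -> gamma' (snd @^-1` B) = gamma (snd @^-1` B)) ->
     \int[gamma]_z (c z)%:E <= \int[gamma']_z (c z)%:E) ->
  \int[gamma]_z (c z)%:E < +oo ->
  perm_eq (unzip1 s) (unzip2 s) -> all (fun e => 0 < m e.1)%R s ->
  \sum_(e <- s) \int[cell e.1]_z (c z)%:E
  <= \sum_(e <- s) \int[indep (fstm (cell e.2)) (sndm (cell e.1))]_z (c z)%:E.
Proof.
move=> opt fin perm charged.
have [a0 a00 a0m] := @lower_bound_seq _ (fun e => m e.1) s charged.
pose a := (a0 / (size s).+1%:R)%R.
have a_gt0 : (0 < a)%R by rewrite divr_gt0.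
pose n i := (count_mem i (unzip1 s))%:R : R.
pose rest i := (m i - a * n i)%R.
have rest0 i : (0 <= rest i)%R.
  rewrite subr_ge0; have [is_|is_] := boolP (i \in unzip1 s); last first.
    by rewrite /n (count_memPn is_) mulr0 cellm_ge0.
  have /mapP[e es ->] := is_.
  apply: le_trans (allP a0m _ es); rewrite /a mulrAC ler_pdivrMr //.
  rewrite ler_wpM2l ?(ltW a00) // ler_nat (leq_trans (count_size _ _)) //.
  by rewrite size_map.
have split_sum (F : I -> \bar R) : (forall i, 0 <= F i) ->
    \sum_i (m i)%:E * F i
    = \sum_i (rest i)%:E * F i + a%:E * \sum_(e <- s) F e.1.
  move=> F0.
  have -> : \sum_(e <- s) F e.1 = \sum_i (n i)%:E * F i.
    rewrite -(big_map fst xpredT F) -[map fst s]/(unzip1 s) /n.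
    elim: (unzip1 s) => [|j t IH].
      by rewrite big_nil big1 // => i _; rewrite mul0e.
    rewrite big_cons IH.
    rewrite [in RHS](eq_bigr (fun i => (if i == j then F j else 0)
      + (count_mem i t)%:R%:E * F i)); last first.
      move=> i _ /=; rewrite natrD EFinD ge0_muleDl ?lee_fin //.
      by rewrite eq_sym; case: eqVneq => [->|_]; rewrite ?mul1e ?mul0e.
    by rewrite big_split /= -big_mkcond big_pred1_eq.
  rewrite ge0_sume_distrr; last by move=> i _; rewrite mule_ge0 // lee_fin.
  rewrite -big_split; apply: eq_bigr => i _ /=.
  rewrite muleA -EFinM -ge0_muleDl ?lee_fin //; last by rewrite mulr_ge0 // ltW.
  by rewrite -EFinD subrK.
pose w (x : I + I * I) := match x with inl i => rest i | inr _ => a end.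
pose P (x : I + I * I) : probability (T1 * T2)%type R := match x with
  | inl i => cell i | inr e => indep (fstm (cell e.2)) (sndm (cell e.1)) end.
pose r := [seq inl i | i <- index_enum I] ++ [seq inr e | e <- s].
have w0 x : (0 <= w x)%R by case: x => [i|e] /=; rewrite ?rest0 // ltW.
have sum_r (F : I + I * I -> \bar R) :
    \sum_(x <- r) F x = \sum_i F (inl i) + \sum_(e <- s) F (inr e).
  by rewrite /r big_cat !big_map.
have w1 : (\sum_(x <- r) w x = 1)%R.
  apply: EFin_inj; rewrite -sumEFin sum_r /=.
  transitivity (\sum_i (m i)%:E * (1 : \bar R)); last first.
    by under eq_bigr do rewrite mule1; rewrite sumEFin cellm_sum.
  rewrite (split_sum (fun=> 1)) // ge0_sume_distrr //.
  by congr (_ + _); apply: eq_bigr => i _; rewrite mule1.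
have [g' [gE gI]] := probability_mix P w0 w1.
have gl : \int[gamma]_z (c z)%:E <= \int[g']_z (c z)%:E.
  apply: opt => A mA; rewrite gE sum_r /=.
    have mA' := @measurable_fst_preimage _ _ T1 T2 _ mA.
    rewrite (total_probability mk gamma mA') split_sum //; congr (_ + _).
    under eq_bigr do rewrite indep_fst //.
    rewrite -ge0_sume_distrr //; congr (_ * _).
    rewrite -(big_map snd xpredT (fun i => cell i (fst @^-1` A))).
    rewrite -(big_map fst xpredT (fun i => cell i (fst @^-1` A))).
    by apply: perm_big; rewrite perm_sym.
  have mA' := @measurable_snd_preimage _ _ T1 T2 _ mA.
  rewrite (total_probability mk gamma mA') split_sum //; congr (_ + _).
  under eq_bigr do rewrite indep_snd //.
  by rewrite -ge0_sume_distrr.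
have mcE : measurable_fun setT (fun z => (c z)%:E) by exact/measurable_EFinP.
have cE0 z : 0 <= (c z)%:E by rewrite lee_fin.
have int0 (Q : probability (T1 * T2)%type R) : 0 <= \int[Q]_z (c z)%:E.
  by apply: integral_ge0 => z _.
move: gl; rewrite gI // sum_r /= (total_expectation mk gamma) // split_sum //.
have restfin : \sum_i (rest i)%:E * \int[cell i]_z (c z)%:E \is a fin_num.
  rewrite ge0_fin_numE; last by apply: sume_ge0 => i _; rewrite mule_ge0 ?lee_fin.
  apply: le_lt_trans fin; rewrite (total_expectation mk gamma) // split_sum //.
  by rewrite leeDl // mule_ge0 ?lee_fin ?(ltW a_gt0) // sume_ge0.
rewrite leeD2lE // -ge0_sume_distrr //.
by rewrite lee_pmul2l // lte_fin.
Qed.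

End Rearrangement.

(** * Borel sets and small cells *)

Section Borel.
Context {R : realType} {d : nat}.

Lemma open_measurable_rV (A : set 'rV[R]_d) : open A -> measurable A.
Proof. by move=> oA; apply: sub_sigma_algebra. Qed.

Lemma compact_measurable_rV (A : set 'rV[R]_d) : compact A -> measurable A.
Proof.
move=> cA; rewrite -[A]setCK; apply: measurableC; apply: open_measurable_rV.
by rewrite openC; apply: compact_closed => //; exact: norm_hausdorff.
Qed.

Lemma measurable_coord (i : 'I_d) : measurable_fun setT (fun x : 'rV[R]_d => x 0 i).
Proof.
apply: (measurability _ (RGenOpens.measurableE R)).
move=> _ [_ [a [b ->] <-]]; rewrite setTI; apply: open_measurable_rV.
have /continuousP := @coord_continuous R 1 d 0 i.
by apply; exact: interval_open.
Qed.

Lemma measurable_enorm dT (T : measurableType dT) (f : T -> 'rV[R]_d) :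
  (forall i, measurable_fun setT (fun z => f z 0 i)) ->
  measurable_fun setT (fun z => enorm (f z)).
Proof.
move=> mf; apply: (measurableT_comp (f := @Num.sqrt R)).
  by apply: continuous_measurable_fun; exact: sqrt_continuous.
by apply: measurable_sum => i; exact: measurable_funX.
Qed.

Lemma measurable_enormB dT (T : measurableType dT) (f g : T -> 'rV[R]_d) :
  measurable_fun setT f -> measurable_fun setT g ->
  measurable_fun setT (fun z => enorm (f z - g z)).
Proof.
move=> mf mg; apply: measurable_enorm => i.
rewrite (_ : (fun z => _) = (fun z => f z 0 i - g z 0 i)); last first.
  by apply/funext => z; rewrite !mxE.
apply: measurable_funB.
  exact: (measurableT_comp (measurable_coord i) mf).
exact: (measurableT_comp (measurable_coord i) mg).
Qed.

Lemma measurable_dist :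
  measurable_fun setT (fun z : 'rV[R]_d * 'rV[R]_d => enorm (z.1 - z.2)).
Proof. exact: measurable_enormB. Qed.

Lemma measurable_far (eta : R) :
  measurable [set z : 'rV[R]_d * 'rV[R]_d | eta <= enorm (z.1 - z.2)].
Proof.
rewrite (_ : [set z | _] = setT `&` (fun z : 'rV[R]_d * 'rV[R]_d =>
    enorm (z.1 - z.2)) @^-1` `[eta, +oo[%classic).
  exact: measurable_dist.
by apply/seteqP; split=> z; rewrite /= in_itv /= andbT; [split|case].
Qed.

Lemma measurable_eball (x : 'rV[R]_d) r : measurable (eball x r).
Proof.
have me : measurable_fun setT (fun y : 'rV[R]_d => enorm (y - x)).
  by apply: measurable_enormB => //; exact: measurable_cst.
rewrite (_ : eball x r = setT `&` (fun y => enorm (y - x)) @^-1` `]-oo, r[%classic).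
  exact: me.
by apply/seteqP; split=> y; rewrite /eball /= in_itv /=; [split|case].
Qed.

Lemma compact_enorm_bounded (X : set 'rV[R]_d) : compact X ->
  exists B : R, forall x y, X x -> X y -> enorm (x - y) <= B.
Proof.
move=> /compact_bounded [M [_ /(_ (M + 1))]]; rewrite ltrDl ltr01 => /(_ erefl) XM.
exists (d%:R * ((M + 1) + (M + 1))) => x y Xx Xy; apply: enorm_le_coord => i.
have coord (z : 'rV[R]_d) : X z -> `|z 0 i| <= M + 1.
  move=> /XM /=; apply: le_trans.
  rewrite [leRHS]/Num.norm /= mx_normrE.
  exact: (le_bigmax _ (fun ij => `|z ij.1 ij.2|) (ord0, i)).
by rewrite !mxE (le_trans (ler_normB _ _)) // lerD // coord.
Qed.

Lemma enorm_le_ediam (X : set 'rV[R]_d) x y : compact X -> X x -> X y ->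
  enorm (x - y) <= ediam X.
Proof.
move=> /compact_enorm_bounded [B XB] Xx Xy; apply: ub_le_sup; last first.
  by exists x => //; exists y.
by exists B => _ [u Xu [v Xv <-]]; exact: XB.
Qed.

Lemma measurable_find (J : Type) (p : 'rV[R]_d -> J -> bool) (L : seq J) i :
  (forall j, measurable [set x | p x j]) -> measurable [set x | find (p x) L = i].
Proof.
move=> mp; elim: L i => [|j L IH] i /=.
  have [->|i0] := eqVneq i 0%N.
    by rewrite (_ : [set _ | _] = setT) //; apply/seteqP; split.
  rewrite (_ : [set _ | _] = set0) //; apply/seteqP; split=> x //= i0'.
  by rewrite i0' eqxx in i0.
case: i => [|i].
  rewrite (_ : [set _ | _] = [set x | p x j]) //.
  by apply/seteqP; split=> x /=; case: (p x j).
rewrite (_ : [set _ | _] = ~` [set x | p x j] `&` [set x | find (p x) L = i]).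
  by apply: measurableI => //; exact: measurableC.
apply/seteqP; split=> x /=; case: (p x j) => //=.
- by move=> [->]; split.
- by case.
- by move=> [_ ->].
Qed.

(** A point is sent to the first ball that contains it in a finite cover of [X];
    the points outside of all the balls form one more cell. *)
Lemma small_cells (X : set 'rV[R]_d) (delta : R) : compact X -> 0 < delta ->
  exists N (k : 'rV[R]_d -> 'I_N), (forall i, measurable (k @^-1` [set i])) /\
    forall x y, X x -> X y -> k x = k y -> enorm (x - y) <= delta.
Proof.
move=> cX delta0; have [X0|/set0P[x0 Xx0]] := eqVneq X set0.
  exists 1%N, (fun=> ord0); split=> [i|x y]; last by rewrite X0.
  rewrite (_ : _ @^-1` _ = setT) //; apply/seteqP; split=> // x _ /=.
  by rewrite [i]ord1.
have [B XB] := compact_enorm_bounded cX.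
pose h := delta / (4 * d.+1%:R).
have h0 : 0 < h by rewrite divr_gt0 // mulr_gt0.
pose L := ballZ d ((B + d.+1%:R * h) / h).
pose p (x : 'rV[R]_d) (w : 'rV[int]_d) :=
  `[< eball (x0 + h *: latv w) (2 * (d.+1%:R * h)) x >].
have dh : d%:R * h < d.+1%:R * h by rewrite ltr_pM2r // ltr_nat.
have pX x : X x -> has (p x) L.
  move=> Xx; have [w xw] := lattice_approx (x - x0) h0.
  apply/hasP; exists w; last first.
    apply/asboolP; rewrite /eball /= opprD addrA (le_lt_trans xw) //.
    by have : 0 < d.+1%:R * h; [rewrite mulr_gt0|lra].
  rewrite mem_ballZ ler_pdivlMr //.
  have -> : enorm (latv w : 'rV[R]_d) * h = enorm (h *: latv w : 'rV[R]_d).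
    by rewrite enormZ gtr0_norm // mulrC.
  have := enormD3 (h *: latv w) (x - x0) 0; rewrite !subr0 enormB.
  by have := XB _ _ Xx Xx0; lra.
have kL x : (find (p x) L < (size L).+1)%N by rewrite ltnS find_size.
exists (size L).+1, (fun x => Ordinal (kL x)); split=> [i|x y Xx Xy].
  rewrite (_ : _ @^-1` _ = [set x | find (p x) L = i]).
    apply: measurable_find => w; rewrite (_ : [set x | _] = eball (x0 + h *: latv w) (2 * (d.+1%:R * h))).
      exact: measurable_eball.
    by apply/seteqP; split=> x /=; [move/asboolP|move=> ?; apply/asboolP].
  apply/seteqP; split=> x /=; first by move=> <-.
  by move=> H; apply: val_inj.
move=> [kxy]; have := nth_find 0 (pX _ Xx); have := nth_find 0 (pX _ Xy).
rewrite kxy; set w := nth _ _ _ => /asboolP yw /asboolP xw.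
have := enormD3 x (x0 + h *: latv w) y; rewrite (enormB (x0 + _) y).
move: xw yw; rewrite /eball /=.
have : 4 * (d.+1%:R * h) = delta.
  rewrite /h; have : 0 < d.+1%:R :> R by [].
  by move: (d.+1%:R : R) => D D0; field; rewrite gt_eqF.
by lra.
Qed.

End Borel.

(** * Approximate subgradients from an optimal plan *)

Section OptimalPlans.
Context {R : realType} {d : nat}.
Local Notation E := 'rV[R]_d.

Lemma coupling_as (X Y : set E) (rho mu : probability E R)
    (gamma : probability (E * E)%type R) :
  measurable X -> measurable Y -> probs_on X rho -> probs_on Y mu ->
  couplings rho mu gamma -> gamma (X `*` Y) = 1%E.
Proof.
move=> mX mY rX mY1 [g1 g2].
rewrite (_ : X `*` Y = (fst @^-1` X) `&` (snd @^-1` Y)).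
  apply: probability_setI1.
  - exact: measurable_fst_preimage.
  - exact: measurable_snd_preimage.
  - by have := g1 X mX; rewrite /pushforward rX.
  - by have := g2 Y mY; rewrite /pushforward mY1.
by apply/seteqP; split=> [[x y] []|[x y] []].
Qed.

Section Potential.
Variables (X Y : set E) (rho mu : probability E R).
Variable gamma : probability (E * E)%type R.
Hypotheses (cX : compact X) (cY : compact Y).
Hypotheses (rX : probs_on X rho) (mY : probs_on Y mu).
Hypothesis opt : optimal_plans rho mu gamma.
Variables (NX NY : nat) (kX : E -> 'I_NX) (kY : E -> 'I_NY) (delta D : R).
Hypotheses (mkX : forall i, measurable (kX @^-1` [set i])).
Hypotheses (mkY : forall i, measurable (kY @^-1` [set i])).
Hypothesis smallX : forall x y, X x -> X y -> kX x = kX y -> enorm (x - y) <= delta.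
Hypothesis smallY : forall x y, Y x -> Y y -> kY x = kY y -> enorm (x - y) <= delta.
Hypothesis XYD : forall x y, X x -> Y y -> enorm (x - y) <= D.

Definition pair_cell (z : E * E) := (kX z.1, kY z.2).

Lemma measurable_pair_cell i : measurable (pair_cell @^-1` [set i]).
Proof.
rewrite (_ : _ @^-1` _ = (fst @^-1` (kX @^-1` [set i.1]))
    `&` (snd @^-1` (kY @^-1` [set i.2]))).
  apply: measurableI; first exact: measurable_fst_preimage.
  exact: measurable_snd_preimage.
case: i => i j; apply/seteqP; split=> -[x y] /=.
  by move=> [xi yj]; split.
by move=> [xi yj]; congr pair; [exact: xi|exact: yj].
Qed.

Local Notation mk := measurable_pair_cell.
Local Notation charged i := (0 < cellm pair_cell gamma i).

Lemma sqr_dist_close x y a b : X x -> Y y -> X a -> Y b ->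
  pair_cell (x, y) = pair_cell (a, b) ->
  enorm (x - y) ^+ 2 <= enorm (a - b) ^+ 2 + 4 * delta * D.
Proof.
move=> Xx Yy Xa Yb [kxa kyb].
have := smallX Xx Xa kxa; have := smallY Yy Yb kyb.
have := XYD Xx Yy; have := XYD Xa Yb.
have := enormD3 x a y; have := enormD3 a b y; rewrite (enormB b y).
have := enorm_ge0 (x - y); have := enorm_ge0 (a - b).
have := enorm_ge0 (x - a); have := enorm_ge0 (y - b).
move: (enorm _) (enorm _) (enorm _) (enorm _) (enorm _) => p q r s t.
move=> *; nra.
Qed.

(** By [optimal_rearrangement], points chosen in the charged cells are cyclically
    monotone for the cost [|x - y|^2], up to an error proportional to the size
    of the cells. Adding [|x|^2] to the potential of these cycles and halving
    turns this cost into the inner product, hence the potential into a convex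
    function. *)
Lemma optimal_plan_subgradient : exists phi p, exists a y : 'I_NX * 'I_NY -> E,
  [/\ subgradient phi p,
      (forall x, exists2 i, charged i & p x = y i),
      (forall i, charged i -> [/\ X (a i), Y (y i) & pair_cell (a i, y i) = i]) &
      forall i z, charged i -> phi (a i) + dot (y i) (z - a i) - 4 * delta * D <= phi z].
Proof.
have mX := compact_measurable_rV cX; have mY' := compact_measurable_rV cY.
have mXY : measurable (X `*` Y) by exact: measurableX.
have [coup mini] := opt.
have gXY : gamma (X `*` Y) = 1%E by apply: coupling_as rX mY coup.
have cond_as i : charged i ->
    condp gamma (mk i) ((X `*` Y) `&` pair_cell @^-1` [set i]) = 1%E.
  by move=> ci; apply: condp_as => //; rewrite -cellmE ?eqe ?gt_eqF //; exact: mk.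
have ptP i : exists z : E * E, charged i -> [/\ X z.1, Y z.2 & pair_cell z = i].
  have [ci|_] := boolP (charged i); last by exists (0, 0).
  have [S0|/set0P[z [[zX zY] zi]]] := eqVneq ((X `*` Y) `&` pair_cell @^-1` [set i]) set0.
    by have := cond_as i ci; rewrite S0 measure0 => /esym/eqP; rewrite onee_eq0.
  by exists z.
have [pt {}ptP] := choice ptP.
pose a i := (pt i).1; pose y i := (pt i).2.
pose J := {i : 'I_NX * 'I_NY | charged i}.
have [j0 _] : exists j : J, true.
  have [j cj|none] := pickP (fun i => charged i); first by exists (Sub j cj).
  have := cellm_sum mk gamma; rewrite big1 => [/esym/eqP|i _].
    by rewrite oner_eq0.
  by apply/eqP; rewrite eq_le (cellm_ge0 mk) andbT leNgt none.
pose cost (z : E * E) := enorm (z.1 - z.2) ^+ 2.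
have mcost : measurable_fun setT cost.
  by apply: measurable_funX; apply: measurable_enormB.
have cost0 z : 0 <= cost z by exact: sqr_ge0.
have fin : (\int[gamma]_z (cost z)%:E < +oo)%E.
  apply: (@le_lt_trans _ _ (D ^+ 2)%:E); last by rewrite ltry.
  apply: (integral_le_as (V := X `*` Y)) => //; first exact: sqr_ge0.
  move=> [x y'] [/= Xx Yy]; rewrite lerXn2r ?nnegrE ?enorm_ge0 //.
    by apply: le_trans (XYD Xx Yy); exact: enorm_ge0.
  exact: XYD.
have minc (g : probability (E * E)%type R) :
    (forall A, measurable A -> g (fst @^-1` A) = gamma (fst @^-1` A)) ->
    (forall B, measurable B -> g (snd @^-1` B) = gamma (snd @^-1` B)) ->
    (\int[gamma]_z (cost z)%:E <= \int[g]_z (cost z)%:E)%E.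
  move=> g1 g2; apply: mini; split=> A mA; rewrite /pushforward.
    by rewrite g1 //; exact: coup.1.
  by rewrite g2 //; exact: coup.2.
pose eps := 4 * delta * D.
pose w (i j : J) := (cost (a (val i), y (val i)) - eps)
  - (cost (a (val j), y (val i)) + eps).
have cyc (i : J) (p : seq J) : \sum_(e <- zip (i :: p) (rcons p i)) w e.1 e.2 <= 0.
  pose s := [seq (val e.1, val e.2) | e <- zip (i :: p) (rcons p i)].
  have perm : perm_eq (unzip1 s) (unzip2 s).
    have -> : unzip1 s = map val (i :: p).
      rewrite -[i :: p in RHS](@unzip1_zip _ _ _ (rcons p i)) ?size_rcons //.
      by rewrite /unzip1 /s -!map_comp.
    have -> : unzip2 s = map val (rcons p i).
      rewrite -[rcons p i in RHS](@unzip2_zip _ _ (i :: p)) ?size_rcons //.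
      by rewrite /unzip2 /s -!map_comp.
    by apply: perm_map; rewrite perm_sym perm_rcons.
  have chs : all (fun e => charged e.1) s.
    by apply/allP => _ /mapP[e _ ->] /=; exact: (valP e.1).
  have H := optimal_rearrangement mcost cost0 mk minc fin perm chs.
  rewrite /w sumrB subr_le0.
  rewrite /s !big_map /= in H.
  rewrite -lee_fin -!sumEFin; refine (le_trans _ (le_trans H _)).
    apply: lee_sum => e _; have ce := valP e.1.
    apply: (integral_ge_as (V := (X `*` Y) `&` pair_cell @^-1` [set val e.1])).
    - by apply: measurableI => //; exact: mk.
    - exact: cond_as.
    - exact: mcost.
    - exact: cost0.
    move=> [x y'] [[/= Xx Yy] xy]; have [Xa Yb kab] := ptP _ ce.
    rewrite lerBlDr; apply: sqr_dist_close => //.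
    by rewrite [RHS]xy -{2}kab; case: (pt _).
  apply: lee_sum => e _; have ce1 := valP e.1; have ce2 := valP e.2.
  pose U1 := X `&` kX @^-1` [set (val e.2).1].
  pose U2 := Y `&` kY @^-1` [set (val e.1).2].
  have mU1 : measurable U1 by exact: measurableI.
  have mU2 : measurable U2 by exact: measurableI.
  apply: (integral_le_as (V := U1 `*` U2)) => //.
  - exact: measurableX.
  - apply: indep_as => //.
      apply: (@probability1_sub _ _ _ _ _ _ _ _ _ (cond_as _ ce2)).
      + by apply: measurableI => //; exact: mk.
      + exact: measurable_fst_preimage.
      move=> z [[Xz Yz] zi]; split=> //=.
      by have <- : pair_cell z = val e.2 := zi.
    apply: (@probability1_sub _ _ _ _ _ _ _ _ _ (cond_as _ ce1)).
    + by apply: measurableI => //; exact: mk.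
    + exact: measurable_snd_preimage.
    move=> z [[Xz Yz] zi]; split=> //=.
    by have <- : pair_cell z = val e.1 := zi.
  - have [Xa Yb _] := ptP _ ce1.
    rewrite addr_ge0 //; rewrite /eps !mulr_ge0 //.
      by apply: le_trans (smallX Xa Xa erefl); exact: enorm_ge0.
    by apply: le_trans (XYD Xa Yb); exact: enorm_ge0.
  move=> [x y'] [[/= Xx kx] [Yy ky]].
  have [_ Yb kab1] := ptP _ ce1; have [Xa _ kab2] := ptP _ ce2.
  apply: sqr_dist_close => //; rewrite /pair_cell /=; congr pair.
    exact: (etrans kx (esym (congr1 fst kab2))).
  exact: (etrans ky (esym (congr1 snd kab1))).
have [h hP] := potential_of_cycles j0 cyc.
pose aJ (j : J) := a (val j); pose yJ (j : J) := y (val j).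
pose H j := (h j + dot (aJ j) (aJ j)) / 2.
have pot i j : H i + dot (yJ i) (aJ j - aJ i) - eps <= H j.
  have := hP i j; rewrite /w /cost /= -/(aJ _) -/(aJ _) -/(yJ _) !sqr_enorm /H.
  rewrite !(dotDl, dotDr, dotNl, dotNr) (dotC (yJ i) (aJ i)) (dotC (yJ i) (aJ j)).
  by lra.
have [phi [p [sg pJ ap]]] := subgradient_of_potential j0 pot.
exists phi, p, a, y; split=> //.
- by move=> x; have [j ->] := pJ x; exists (val j) => //; exact: (valP j).
- by move=> i z ci; have := ap (Sub i ci) z.
Qed.

End Potential.
End OptimalPlans.

(** * Coupling two plans with the same first marginal *)

Section Gluing.
Context {d1 d2 : measure_display} {T1 : measurableType d1}
  {T2 : measurableType d2} {R : realType}.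
Variables gamma0 gamma1 : probability (T1 * T2)%type R.
Hypothesis same_fst : forall A, measurable A ->
  gamma0 (fst @^-1` A) = gamma1 (fst @^-1` A).
Variables (I : finType) (k : T1 -> I).
Hypothesis mk : forall i, measurable (k @^-1` [set i]).
Variables (Z : set (T1 * T2)) (f : (T1 * T2) * (T1 * T2) -> R) (B : I -> R).
Hypotheses (mZ : measurable Z) (Z0 : gamma0 Z = 1%E) (Z1 : gamma1 Z = 1%E).
Hypotheses (mf : measurable_fun setT f) (f0 : forall z, 0 <= f z).
Hypothesis B0 : forall i, 0 <= B i.
Hypothesis fB : forall z0 z1, Z z0 -> Z z1 -> k z0.1 = k z1.1 -> f (z0, z1) <= B (k z0.1).

Definition fst_cell (z : T1 * T2) := k z.1.

Lemma measurable_fst_cell i : measurable (fst_cell @^-1` [set i]).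
Proof. exact: (@measurable_fst_preimage _ _ T1 T2 _ (mk i)). Qed.

Local Notation mfk := measurable_fst_cell.

(** On each cell of the first factor, the restrictions of the two plans are coupled
    independently. A gluing along the common first marginal would keep the first
    coordinates equal but requires a disintegration; here they stay in the same
    cell. *)
Lemma glued_coupling : exists2 pi, couplings gamma0 gamma1 pi &
  (\int[pi]_z (f z)%:E <= \sum_i (cellm fst_cell gamma0 i * B i)%:E)%E.
Proof.
pose P i := indep (condp gamma0 (mfk i)) (condp gamma1 (mfk i)).
have [pi [piE piI]] := probability_mix P (cellm_ge0 mfk gamma0) (cellm_sum mfk gamma0).
have m01 i : cellm fst_cell gamma0 i = cellm fst_cell gamma1 i.
  by congr fine; exact: (same_fst (mk i)).
exists pi.
  split=> A mA; rewrite /pushforward piE.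
    by rewrite (total_probability mfk) //; apply: eq_bigr => i _; rewrite indep_fst.
  rewrite (total_probability mfk) //; apply: eq_bigr => i _.
  by rewrite m01 indep_snd.
rewrite piI; first last.
- by move=> z; rewrite lee_fin.
- exact/measurable_EFinP.
apply: lee_sum => i _; rewrite EFinM.
have := cellm_ge0 mfk gamma0 i; rewrite le_eqVlt => /predU1P[<-|mi].
  by rewrite !mul0e.
apply: lee_wpmul2l; first by rewrite lee_fin ltW.
have cell1 (g : probability (T1 * T2)%type R) : g Z = 1%E ->
    cellm fst_cell g i != 0 -> condp g (mfk i) (Z `&` fst_cell @^-1` [set i]) = 1%E.
  move=> gZ gi; apply: condp_as => //; apply: contra gi => /eqP g0.
  by rewrite /cellm g0.
have mZi : measurable (Z `&` fst_cell @^-1` [set i]).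
  by apply: measurableI => //; exact: mfk.
apply: (integral_le_as (V := (Z `&` fst_cell @^-1` [set i]) `*` (Z `&` fst_cell @^-1` [set i]))) => //.
- exact: measurableX.
- by apply: indep_as => //; apply: cell1; rewrite -?m01 ?gt_eqF.
move=> [z0 z1] [/= [Zz0 z0i] [Zz1 z1i]].
have <- : k z0.1 = i := z0i.
by apply: fB => //; rewrite [LHS]z0i [RHS]z1i.
Qed.

End Gluing.

Section IndicatorSums.
Context {dT : measure_display} {T : measurableType dT} {R : realType}.
Local Open Scope ereal_scope.

Lemma integral_indic_sum (P : probability T R) (L : seq (R * set T)) :
  (forall u, u \in L -> 0 <= u.1)%R -> (forall u, u \in L -> measurable u.2) ->
  \int[P]_x (\sum_(u <- L) u.1 * \1_(u.2) x)%R%:E = \sum_(u <- L) u.1%:E * P u.2.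
Proof.
elim: L => [|u L IH] L0 mL.
  rewrite big_nil; under eq_integral do rewrite big_nil.
  by rewrite integral0.
have L0' v : v \in L -> (0 <= v.1)%R by move=> vL; apply: L0; rewrite inE vL orbT.
have mL' v : v \in L -> measurable v.2 by move=> vL; apply: mL; rewrite inE vL orbT.
have u0 : (0 <= u.1)%R by apply: L0; rewrite mem_head.
have mu : measurable u.2 by apply: mL; rewrite mem_head.
rewrite big_cons -IH //; under eq_integral do rewrite big_cons EFinD.
have mrest : measurable_fun setT (fun x => \sum_(v <- L) v.1 * \1_(v.2) x)%R.
  elim: L {IH L0 mL L0'} mL' => [|v L IH] mL.
    by under eq_fun do rewrite big_nil; exact: measurable_cst.
  under eq_fun do rewrite big_cons.
  apply: measurable_funD; last by apply: IH => w wL; apply: mL; rewrite inE wL orbT.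
  by apply: measurable_funM => //; apply: measurable_indic; apply: mL; rewrite mem_head.
rewrite ge0_integralD //; first last.
- exact/measurable_EFinP.
- move=> x _; rewrite lee_fin big_seq_cond; apply: sumr_ge0 => v /andP[vL _].
  by rewrite mulr_ge0 // L0'.
- apply/measurable_EFinP; apply: measurable_funM => //; exact: measurable_indic.
- by move=> x _; rewrite lee_fin mulr_ge0.
congr (_ + _); under eq_integral do rewrite EFinM.
rewrite ge0_integralZl //; first by rewrite integral_indic // setIT.
- by apply/measurable_EFinP; exact: measurable_indic.
Qed.

End IndicatorSums.

(** * The estimate of the distance between two optimal plans *)

Section MainEstimate.
Context {R : realType} {n : nat}.
Local Notation d := n.+1.
Local Notation E := 'rV[R]_d.

(** The average of the two plans: what holds almost surely for it holds almost
    surely for both, so that one convex potential describes both plans. *)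
Lemma optimal_plans_mix (rho mu : probability E R)
    (gamma0 gamma1 : probability (E * E)%type R) :
  optimal_plans rho mu gamma0 -> optimal_plans rho mu gamma1 ->
  exists2 gamma, optimal_plans rho mu gamma &
    forall A, gamma A = 1%E -> measurable A -> gamma0 A = 1%E /\ gamma1 A = 1%E.
Proof.
move=> [[f0 s0] o0] [[f1 s1] o1].
have h0 (b : bool) : 0 <= 1 / 2 :> R by [].
have h1 : \sum_(b <- [:: false; true]) (1 / 2 : R) = 1.
  by rewrite !big_cons big_nil addr0 -splitr.
have [g [gE gI]] := probability_mix (fun b : bool => if b then gamma1 else gamma0) h0 h1.
have half (x : \bar R) : (0 <= x)%E -> ((1 / 2)%:E * x + (1 / 2)%:E * x = x)%E.
  move=> x0; rewrite -ge0_muleDl ?lee_fin // -EFinD -splitr.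
  by rewrite mul1e.
have {}gE A : g A = ((1 / 2)%:E * gamma0 A + (1 / 2)%:E * gamma1 A)%E.
  by rewrite gE !big_cons big_nil adde0.
exists g.
  split.
    split=> A mA; rewrite /pushforward gE.
      by have := f0 A mA; have := f1 A mA; rewrite /pushforward => -> ->; rewrite half.
    by have := s0 A mA; have := s1 A mA; rewrite /pushforward => -> ->; rewrite half.
  move=> g' cg'; rewrite /quadratic_cost gI; first last.
  - by move=> z; rewrite lee_fin sqr_ge0.
  - apply/measurable_EFinP; apply: measurable_funX; exact: measurable_enormB.
  rewrite !big_cons big_nil adde0 -[leRHS]half.
    by apply: leeD; apply: lee_wpmul2l => //; [exact: o0|exact: o1].
  by apply: integral_ge0 => z _; rewrite lee_fin sqr_ge0.
move=> A gA mA.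
have gAC : g (~` A) = 0%E by rewrite probability_setC // gA subee.
have null (h : probability (E * E)%type R) : ((1 / 2)%:E * h (~` A) <= 0)%E -> h A = 1%E.
  move=> hA; have hA0 : h (~` A) = 0%E.
    apply/eqP; rewrite eq_le measure_ge0 andbT.
    by move: hA; rewrite pmule_rle0 // lte_fin.
  by rewrite -[A]setCK probability_setC ?hA0 ?sube0 //; exact: measurableC.
split; apply: null; rewrite -gAC gE.
  by rewrite leeDl // mule_ge0.
by rewrite leeDr // mule_ge0.
Qed.

Lemma powR_le_mul (x D q : R) : 1 <= q -> 0 <= x -> x <= D ->
  x `^ q <= D `^ (q - 1) * x.
Proof.
move=> q1 x0 xD; have q0 : 0 < q by lra.
rewrite -(mulr_powRB1 x0 q0) [leRHS]mulrC ler_wpM2l // ge0_ler_powR ?nnegrE //; lra.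
Qed.

(** The two plans are coupled cell by cell. The cost on an [x]-cell is at most a
    power of the greatest distance [v] between subgradients charged there, and
    [v] at [x] is bounded by [flux_majorant] at every [x'] within [eta] of [x]: this
    transports the estimate along [sigma] from [rho] to [rhot], whose mass in
    balls is controlled by [m]. Where [sigma] moves by [eta] or more, [v] is at
    most the diameter of [Y]. The strict inequality [DY < D'] leaves room for the
    size of the cells. *)
Lemma main_estimate (X Y : set E) (rho mu rhot : probability E R)
    (gamma0 gamma1 : probability (E * E)%type R) sigma
    (q r s t eta D DY D' m : R) :
  (0 < n)%N -> 1 <= q -> compact X -> compact Y ->
  probs_on X rho -> probs_on Y mu -> probs_on X rhot ->
  optimal_plans rho mu gamma0 -> optimal_plans rho mu gamma1 ->
  couplings rho rhot sigma ->
  0 < t -> 0 < s -> 0 <= eta -> eta + t + s < r ->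
  (forall x x', X x -> X x' -> enorm (x - x') <= D) ->
  (forall y y', Y y -> Y y' -> enorm (y - y') <= DY) -> DY < D' ->
  0 <= m -> (forall z, (rhot (eball z r) <= m%:E)%E) ->
  (ereal_inf [set \int[pi]_(z in setT)
      ((enorm (z.1.1 - z.2.1)%R) `^ q + (enorm (z.1.2 - z.2.2)%R) `^ q)%R%:E
    | pi in couplings gamma0 gamma1]
  <= (D' `^ q * (d%:R / t * (r * r * (D + r) ^+ n / (s ^+ n * (ball_ratio n * s))) * m))%:E
     + (D' `^ q)%:E * sigma [set z | (eta <= enorm (z.1 - z.2))%R])%E.
Proof.
move=> n0 q1 cX cY rX mY tX opt0 opt1 coup t0 s0 eta0 etar XD YD DYD' m0 tball.
set G := _ / (s ^+ n * _).
set far := [set z | _].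
have mX := compact_measurable_rV cX; have mY' := compact_measurable_rV cY.
have [x0 Xx0] : exists x, X x.
  apply/set0P; apply/eqP => X0; have := rX; rewrite /probs_on /= X0 measure0.
  by move=> /esym/eqP; rewrite onee_eq0.
have [y0 Yy0] : exists y, Y y.
  apply/set0P; apply/eqP => Y0; have := mY; rewrite /probs_on /= Y0 measure0.
  by move=> /esym/eqP; rewrite onee_eq0.
have D0 : 0 <= D by apply: le_trans (XD _ _ Xx0 Xx0); exact: enorm_ge0.
have DY0 : 0 <= DY by apply: le_trans (YD _ _ Yy0 Yy0); exact: enorm_ge0.
have D'0 : 0 < D' by lra.
have [Dm XYm] : exists Dm, forall x y, X x -> Y y -> enorm (x - y) <= Dm.
  have [Dm H] := compact_enorm_bounded (compactU cX cY).
  by exists Dm => x y Xx Yy; apply: H; [left|right].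
have Dm0 : 0 <= Dm by apply: le_trans (XYm _ _ Xx0 Yy0); exact: enorm_ge0.
have [gamma optg gas] := optimal_plans_mix opt0 opt1.
have coupg := optg.1.
have mfar : measurable far := measurable_far eta.
set P1 := D' `^ (q - 1).
have P10 : 0 <= P1 by exact: powR_ge0.
apply/lee_addgt0Pr => e e0.
pose K := 1 + P1 * (2 / t * (4 * Dm) + 1 + 2 + m).
have K0 : 0 < K by rewrite ltr_pwDl // mulr_ge0 // !addr_ge0 // !mulr_ge0 // invr_ge0 ltW.
(* one parameter controls the size of the cells and the discretization error *)
have [delta [[delta0 d1 dD' dr] dK]] : exists delta, [/\ 0 < delta, delta <= 1,
    2 * delta <= D' - DY & eta + delta + t + s < r] /\ delta * K <= e.
  pose delta := Num.min (Num.min 1 ((D' - DY) / 2))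
    (Num.min ((r - (eta + t + s)) / 2) (e / K)).
  exists delta.
  have l1 : delta <= 1 by rewrite /delta !ge_min lexx.
  have l2 : delta <= (D' - DY) / 2 by rewrite /delta !ge_min lexx orbT.
  have l3 : delta <= (r - (eta + t + s)) / 2 by rewrite /delta !ge_min lexx !orbT.
  have l4 : delta <= e / K by rewrite /delta !ge_min lexx !orbT.
  have l0 : 0 < delta.
    have h1 : 0 < (D' - DY) / 2 by lra.
    have h2 : 0 < (r - (eta + t + s)) / 2 by lra.
    by rewrite /delta !lt_min h1 h2 divr_gt0 ?ltr01.
  split; last by rewrite -ler_pdivlMr.
  by split=> //; lra.
have [NX [kX [mkX smallX]]] := small_cells cX delta0.
have [NY [kY [mkY smallY]]] := small_cells cY delta0.
have [phi [p [a [y [sg pY ayP sub]]]]] :=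
  optimal_plan_subgradient cX cY rX mY optg mkX mkY smallX smallY XYm.
set charged := (fun i => 0 < cellm (pair_cell kX kY) gamma i) in pY ayP sub.
have pD x x' : enorm (p x - p x') <= D'.
  have [i ci ->] := pY x; have [j cj ->] := pY x'.
  have [_ Yi _] := ayP i ci; have [_ Yj _] := ayP j cj.
  by apply: le_trans (ltW DYD'); exact: YD.
have eta1 : 0 <= eta + delta by lra.
have [l [l0 lsum] lP] := flux_majorant x0 n0 sg pD D0 t0 s0 eta1 dr delta0.
pose U x := 2 / t * (4 * delta * Dm) + delta
  + \sum_(u <- l) u.1 * (enorm (x - u.2) < r)%R%:R.
have U0 x : 0 <= U x.
  rewrite /U !addr_ge0 ?mulr_ge0 ?invr_ge0 ?(ltW t0) ?(ltW delta0) //.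
  by rewrite big_seq_cond; apply: sumr_ge0 => u /andP[ul _]; rewrite mulr_ge0 ?l0.
pose v i := \big[Num.max/0]_(e : 'I_NY * 'I_NY | charged (i, e.1) && charged (i, e.2))
   enorm (y (i, e.1) - y (i, e.2)).
have v0 i : 0 <= v i by apply: bigmax_ge_id.
have vD i : v i <= DY.
  apply: bigmax_le => // -[j j'] /= /andP[c1 c2].
  by have [_ Yj _] := ayP _ c1; have [_ Yj' _] := ayP _ c2; exact: YD.
have vU x x' : X x -> X x' -> enorm (x - x') < eta -> v (kX x) <= U x'.
  move=> Xx Xx' xx'; apply: bigmax_le => // -[j j'] /= /andP[c1 c2].
  have [Xa1 _ [ka1 _]] := ayP _ c1; have [Xa2 _ [ka2 _]] := ayP _ c2.
  apply: (lP _ x' _ _ (a (kX x, j')) (a (kX x, j))).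
  - exact: XD.
  - by move=> z; exact: sub.
  - by move=> z; exact: sub.
  - have := enormD3 (a (kX x, j')) x x'; have := smallX _ _ Xa2 Xx ka2; lra.
  - have := enormD3 (a (kX x, j)) x x'; have := smallX _ _ Xa1 Xx ka1; lra.
pose B i := delta + (v i + 2 * delta) `^ q.
pose Z := (X `*` Y) `&` [set z | charged (pair_cell kX kY z)].
have mpc := measurable_pair_cell mkX mkY.
have mC : measurable [set z | charged (pair_cell kX kY z)].
  exact: (measurable_cell_pred mpc charged).
have mZ : measurable Z by apply: measurableI => //; exact: measurableX.
have gZ : gamma Z = 1%E.
  apply: probability_setI1 => //; first exact: measurableX.
    exact: coupling_as rX mY coupg.
  exact: charged_as.
have [gZ0 gZ1] := gas _ gZ mZ.
have same A : measurable A -> gamma0 (fst @^-1` A) = gamma1 (fst @^-1` A).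
  by move=> mA; rewrite -[LHS]/(pushforward gamma0 fst A) opt0.1.1 // -opt1.1.1.
pose f (z : (E * E) * (E * E)) :=
  enorm (z.1.1 - z.2.1) `^ q + enorm (z.1.2 - z.2.2) `^ q.
have mf : measurable_fun setT f.
  have mq := @measurable_powR R q.
  apply: measurable_funD.
    apply: (measurableT_comp (f := fun x : R => x `^ q)) => //.
    by apply: measurable_enormB; apply: measurableT_comp.
  apply: (measurableT_comp (f := fun x : R => x `^ q)) => //.
  by apply: measurable_enormB; apply: measurableT_comp.
have f0 z : 0 <= f z by rewrite addr_ge0 // powR_ge0.
have B0 i : 0 <= B i by rewrite addr_ge0 ?powR_ge0 // ltW.
have fB z0 z1 : Z z0 -> Z z1 -> kX z0.1 = kX z1.1 -> f (z0, z1) <= B (kX z0.1).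
  move=> [[Xz0 Yz0] c0] [[Xz1 Yz1] c1] k01; rewrite /f /B /= lerD //.
    have xx := smallX _ _ Xz0 Xz1 k01.
    apply: (@le_trans _ _ (delta `^ q)).
      by rewrite ge0_ler_powR ?nnegrE ?enorm_ge0 //; lra.
    rewrite -[leRHS]powRr1 ?(ltW delta0) //.
    by rewrite ger_powR // delta0.
  rewrite ge0_ler_powR ?nnegrE ?enorm_ge0 ?addr_ge0 ?mulr_ge0 ?(ltW delta0) //; first lra.
  have [_ Ya0 [_ ky0]] := ayP _ c0.
  have c1' : charged (kX z0.1, kY z1.2) by rewrite k01.
  have [_ Ya1 [_ ky1]] := ayP _ c1'.
  have vv : enorm (y (kX z0.1, kY z0.2) - y (kX z0.1, kY z1.2)) <= v (kX z0.1).
    apply: (le_bigmax_cond _ (fun e => enorm (y (kX z0.1, e.1) - y (kX z0.1, e.2)))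
      (j := (kY z0.2, kY z1.2))).
    by rewrite /= c1' andbT.
  have := smallY _ _ Yz0 Ya0 (esym ky0); have := smallY _ _ Ya1 Yz1 ky1.
  have := enormD3 z0.2 (y (kX z0.1, kY z0.2)) z1.2.
  have := enormD3 (y (kX z0.1, kY z0.2)) (y (kX z0.1, kY z1.2)) z1.2.
  lra.
have [pi cpi intpi] := glued_coupling same mkX mZ gZ0 gZ1 mf f0 B0 fB.
apply: le_trans (_ : _ <= \int[pi]_z (f z)%:E)%E _.
  by apply: ereal_inf_lbound; exists pi.
apply: le_trans intpi _.
(* the cost is dominated by a sum of indicators, evaluated on the marginals of sigma *)
have cellsig i : cellm (fst_cell kX) gamma0 i = cellm (fst_cell kX) sigma i.
  congr fine; rewrite -[LHS]/(pushforward gamma0 fst (kX @^-1` [set i])).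
  by rewrite opt0.1.1 // -coup.1.
pose L := (delta + P1 * (2 / t * (4 * delta * Dm) + delta + 2 * delta), setT) ::
  (D' `^ q, far) :: [seq (P1 * u.1, snd @^-1` (eball u.2 r)) | u <- l].
have L0 u : u \in L -> 0 <= u.1.
  rewrite !inE => /or3P[/eqP->|/eqP->|/mapP[w wl ->]] /=.
  - by rewrite !addr_ge0 ?mulr_ge0 ?addr_ge0 ?mulr_ge0 ?invr_ge0 ?(ltW t0) ?(ltW delta0).
  - exact: powR_ge0.
  - by rewrite mulr_ge0 // l0.
have mL (u : R * set (E * E)) : u \in L -> measurable u.2.
  rewrite !inE => /or3P[/eqP->|/eqP->|/mapP[w wl ->]] //=.
  by apply: measurable_snd_preimage; exact: measurable_eball.
pose H (z : E * E) := \sum_(u <- L) u.1 * \1_(u.2) z.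
have BH z : X z.1 -> X z.2 -> B (kX z.1) <= H z.
  move=> Xz1 Xz2; rewrite /H /L !big_cons big_map /=.
  rewrite [X in _ + X]addrC.
  have -> : \sum_(u <- l) P1 * u.1 * \1_(snd @^-1` eball u.2 r) z
      = P1 * \sum_(u <- l) u.1 * (enorm (z.2 - u.2) < r)%R%:R.
    rewrite mulr_sumr; apply: eq_bigr => u _; rewrite -mulrA indicE; congr (_ * (_ * _%:R)).
    by congr nat_of_bool; apply/idP/idP => [/set_mem|zu]; [|apply/mem_set].
  rewrite !indicE in_setT mulr1 /B -!addrA lerD2l.
  have vz0 : 0 <= v (kX z.1) + 2 * delta by rewrite addr_ge0 // mulr_ge0 // ltW.
  have vzD : v (kX z.1) + 2 * delta <= D' by have := vD (kX z.1); lra.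
  have Uz := U0 z.2; rewrite /U in Uz.
  have [zfar|znear] := leP eta (enorm (z.1 - z.2)).
    rewrite (mem_set (zfar : far z)) mulr1 addrA -mulrDr ler_wpDl //.
      by rewrite mulr_ge0 //; lra.
    by rewrite ge0_ler_powR ?nnegrE //; lra.
  apply: (@le_trans _ _ (P1 * (v (kX z.1) + 2 * delta))); first exact: powR_le_mul.
  rewrite addrA -mulrDr ler_wpDr //; first by rewrite mulr_ge0 // powR_ge0.
  by rewrite ler_wpM2l //; have := vU _ _ Xz1 Xz2 znear; rewrite /U; lra.
have mH : measurable_fun setT H.
  rewrite /H; elim: L {L0 BH H} mL => [|u L IH] mL.
    by under eq_fun do rewrite big_nil; exact: measurable_cst.
  under eq_fun do rewrite big_cons.
  apply: measurable_funD; last by apply: IH => w wL; apply: mL; rewrite inE wL orbT.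
  by apply: measurable_funM => //; apply: measurable_indic; apply: mL; rewrite mem_head.
have H0 z : 0 <= H z.
  by rewrite /H big_seq_cond; apply: sumr_ge0 => u /andP[uL _]; rewrite mulr_ge0 // L0.
have mfk := measurable_fst_cell (T2 := E) mkX.
have sXX : sigma (X `*` X) = 1%E by exact: coupling_as rX tX coup.
apply: (@le_trans _ _ (\int[sigma]_z (H z)%:E)%E).
  rewrite (total_expectation mfk sigma); first last.
  - by move=> z; rewrite lee_fin.
  - exact/measurable_EFinP.
  apply: lee_sum => i _; rewrite cellsig EFinM.
  have := cellm_ge0 mfk sigma i; rewrite le_eqVlt => /predU1P[<-|mi].
    by rewrite !mul0e.
  apply: lee_wpmul2l; first by rewrite lee_fin ltW.
  apply: (integral_ge_as (V := (X `*` X) `&` fst_cell kX @^-1` [set i])) => //.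
  - by apply: measurableI; [exact: measurableX|exact: mfk].
  - apply: condp_as => //; first exact: measurableX.
    by apply/eqP => si; move: mi; rewrite /cellm si ltxx.
  by move=> z [[Xz1 Xz2] zi]; have <- : kX z.1 = i := zi; exact: BH.
rewrite integral_indic_sum // /L !big_cons big_map /= probability_setT mule1.
have sball z : sigma (snd @^-1` eball z r) = rhot (eball z r).
  by rewrite -[LHS]/(pushforward sigma snd (eball z r)) coup.2 //; exact: measurable_eball.
set S := (\sum_(j <- l) _)%E.
have SE : (S <= (P1 * (d%:R * D' / t * G + delta) * m)%:E)%E.
  apply: (@le_trans _ _ (\sum_(u <- l) (P1 * u.1 * m)%:E)%E).
    rewrite /S big_seq_cond [leRHS]big_seq_cond.
    apply: lee_sum => u /andP[ul _]; rewrite sball [leRHS]EFinM.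
    by apply: lee_wpmul2l; rewrite // lee_fin mulr_ge0 // l0.
  rewrite sumEFin lee_fin -mulr_suml -mulr_sumr ler_wpM2r // ler_wpM2l //.
have DP : D' `^ q = P1 * D'.
  by rewrite /P1 mulrC mulr_powRB1 ?(ltW D'0) //; lra.
rewrite addeCA addeAC [leRHS]addeC leeD2l //.
apply: le_trans (leeD2l _ SE) _; rewrite -!EFinD lee_fin DP.
move: dK; rewrite /K.
have -> : 2 / t * (4 * delta * Dm) = delta * (2 / t * (4 * Dm)) by ring.
move: (2 / t * (4 * Dm)) => w dK.
have -> : P1 * (d%:R * D' / t * G + delta) * m
    = P1 * D' * (d%:R / t * G * m) + P1 * delta * m by ring.
by move: (_ * (_ / t * G * m)) => W; nra.
Qed.

End MainEstimate.

(** * Volumes of Euclidean balls *)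

Section UnitBall.
Context {R : realType}.
Local Notation mu := (@lebesgue_measure R).

Lemma integral_dilation (s : R) (g : R -> \bar R) : 0 < s ->
  measurable_fun setT g -> (forall x, (0 <= g x)%E) ->
  (\int[mu]_t g t = s%:E * \int[mu]_t g (s * t)%R)%E.
Proof.
move=> s0 mg g0; pose f (x : measurableTypeR R) : measurableTypeR R := s * x.
have mf : measurable_fun setT f by exact: measurable_funM.
pose pf : {measure set (measurableTypeR R) -> \bar R} :=
  measure_function_pushforward__canonical__measure_function_Measure mu mf.
pose nu := mscale (NngNum (ltW s0)) pf.
have E A : measurable A -> mu A = nu A.
  apply: lebesgue_measure_unique => _ [[a b]] _ <-.
  rewrite /nu /= /mscale /= /pushforward.
  rewrite (_ : f @^-1` _ = `]a / s, b / s]%classic); last first.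
    apply/seteqP; split=> x; rewrite /f /= !in_itv /= ltr_pdivrMr // ler_pdivlMr //;
    by rewrite mulrC.
  rewrite !lebesgue_measure_itv /= !lte_fin ltr_pM2r ?invr_gt0 //.
  case: ifPn => _; last by rewrite mule0.
  by rewrite -!EFinB -mulrBl -EFinM mulrCA mulfV ?mulr1 // gt_eqF.
transitivity (\int[nu]_t g t)%E.
  by apply: eq_measure_integral => A mA _; exact: E.
rewrite ge0_integral_mscale //; congr (_ * _)%E.
by rewrite [LHS]ge0_integral_pushforward.
Qed.

Lemma lebesgue_vol0 k : lebesgue_vol (set0 : set 'rV[R]_k) = 0%E.
Proof.
elim: k => [|k IH] /=; first by rewrite dirac0.
by apply: integral0_eq => t _; rewrite -[RHS]IH; congr lebesgue_vol; apply/seteqP; split.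
Qed.

Lemma ball_section k (r t : R) : 0 < r ->
  [set y : 'rV[R]_k | eball (0 : 'rV[R]_k.+1) r (row_mx (t%:M : 'rV[R]_1) y)]
  = if t ^+ 2 < r ^+ 2 then eball 0 (Num.sqrt (r ^+ 2 - t ^+ 2)) else set0.
Proof.
move=> r0; have E (y : 'rV[R]_k) :
    enorm (row_mx (t%:M : 'rV[R]_1) y : 'rV[R]_k.+1) ^+ 2 = t ^+ 2 + enorm y ^+ 2.
  rewrite !sqr_enorm /dot -[X in \sum_(_ < X) _]/(1 + k)%N big_split_ord big_ord1.
  congr (_ + _); [by rewrite (@row_mxEl _ 1 1 k) mxE eqxx mulr1n expr2|].
  by apply: eq_bigr => i _; rewrite (@row_mxEr _ 1 1 k).
have lt_sqr (x y : R) : 0 <= x -> 0 <= y -> (x < y) = (x ^+ 2 < y ^+ 2).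
  by move=> x0 y0; rewrite ltr_pXn2r ?nnegrE.
apply/seteqP; split=> y; rewrite /eball /= subr0 (lt_sqr (enorm _)) ?enorm_ge0 ?(ltW r0) // E.
  move=> H; have tr : t ^+ 2 < r ^+ 2 by have := sqr_ge0 (enorm y); lra.
  rewrite tr /= subr0 lt_sqr ?enorm_ge0 ?sqrtr_ge0 //.
  by rewrite [Num.sqrt (_ - _) ^+ 2]sqr_sqrtr; lra.
case: ifPn => // tr /=; rewrite subr0 lt_sqr ?enorm_ge0 ?sqrtr_ge0 //.
by rewrite [Num.sqrt (_ - _) ^+ 2]sqr_sqrtr; lra.
Qed.

(** The volume of the slice at height [t] of the unit ball of [R^(k+1)], relative
    to the volume of the unit ball of [R^k]. *)
Definition profile k (t : R) : R := \1_(`]-1, 1[%classic) t * Num.sqrt (1 - t ^+ 2) ^+ k.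

Lemma measurable_profile k : measurable_fun setT (profile k).
Proof.
apply: measurable_funM; first exact: measurable_indic.
apply: measurable_funX; apply: (measurableT_comp (f := @Num.sqrt R)).
  by apply: continuous_measurable_fun; exact: sqrt_continuous.
apply: measurable_funB; first exact: measurable_cst.
exact: measurable_funX.
Qed.

Lemma profile_ge0 k t : 0 <= profile k t.
Proof. by rewrite mulr_ge0 // exprn_ge0 // sqrtr_ge0. Qed.

Lemma profileE k t : profile k t = if t ^+ 2 < 1 then Num.sqrt (1 - t ^+ 2) ^+ k else 0.
Proof.
rewrite /profile indicE; case: ifPn => t1.
  rewrite mem_set ?mul1r //= in_itv /=; apply/andP; split; nra.
rewrite memNset ?mul0r //= in_itv /= => /andP[t1' t1'']; move: t1; rewrite -leNgt; nra.
Qed.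

Lemma integral_parabola (m : R) : 0 < m ->
  (\int[mu]_(t in `[(- (Num.sqrt m)^-1)%R, ((Num.sqrt m)^-1)%R]) (1 - m * t ^+ 2)%:E
   = (4 / (3 * Num.sqrt m))%:E)%E.
Proof.
move=> m0; set x := (Num.sqrt m)^-1.
have x0 : 0 < x by rewrite invr_gt0 sqrtr_gt0.
pose F (t : R) := t - m / 3 * t ^+ 3.
have dF (t : R) : is_derive t (1 : R) F (1 - m * t ^+ 2).
  by apply: is_derive_eq; rewrite /GRing.scale /=; field.
have cF : continuous (F : R -> R).
  by move=> t; apply/differentiable_continuous/derivable1_diffP.
rewrite (@continuous_FTC2 _ _ F).
- rewrite -EFinB /F; congr EFin.
  have mx : m * x ^+ 2 = 1.
    by rewrite /x exprVn sqr_sqrtr ?(ltW m0) // divff // gt_eqF.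
  rewrite [RHS](_ : _ = 4 / 3 * x); last by rewrite /x invfM mulrA.
  rewrite [in LHS](_ : x - _ - _ = 2 * x - 2 / 3 * x * (m * x ^+ 2)); last by ring.
  by rewrite mx; lra.
- by rewrite gtrN.
- apply: continuous_subspaceT => t.
  apply: cvgB; first exact: cvg_cst.
  by apply: cvgMr; exact: exprn_continuous.
- split.
  + by move=> t _; apply: ex_derive.
  + by apply: cvg_at_right_filter; exact: cF.
  + by apply: cvg_at_left_filter; exact: cF.
- by move=> t _; rewrite derive1E; apply: derive_val.
Qed.

(** The profile dominates the parabola of [expr_ge_parabola] where the latter is
    nonnegative. *)
Lemma integral_profile_ge k : ((ball_ratio k)%:E <= \int[mu]_t (profile k t)%:E)%E.
Proof.
set m : R := (k%:R + 2) / 2.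
have m1 : 1 <= m by rewrite /m; have : 0 <= k%:R :> R by []; lra.
have m0 : 0 < m by lra.
rewrite /ball_ratio -/m -integral_parabola //.
set x := (Num.sqrt m)^-1.
have mprof : measurable_fun setT (fun t : R => (profile k t)%:E).
  by apply/measurable_EFinP; exact: measurable_profile.
apply: (@le_trans _ _ (\int[mu]_(t in `[(- x)%R, x]) (profile k t)%:E)%E); last first.
  apply: ge0_subset_integral => //.
  by move=> t _; rewrite lee_fin profile_ge0.
have x1 : x ^+ 2 = m^-1 by rewrite /x exprVn sqr_sqrtr // ltW.
have par t : - x <= t <= x -> 1 - m * t ^+ 2 <= profile k t /\ 0 <= 1 - m * t ^+ 2.
  move=> tx; have := ler_sqr_norm tx; rewrite x1 => t2.
  have mt : m * t ^+ 2 <= 1 by rewrite -ler_pdivlMl // mulr1.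
  split; last lra.
  rewrite profileE; case: ltP => t1; last by nra.
  have t0 := sqr_ge0 t.
  apply: le_trans (expr_ge_parabola k (_ : 0 <= Num.sqrt (1 - t ^+ 2) <= 1)).
    by rewrite sqr_sqrtr ?subKr //; lra.
  by rewrite sqrtr_ge0 -{2}sqrtr1 ler_wsqrtr //; lra.
apply: ge0_le_integral => //.
- by move=> t; rewrite /= in_itv /= lee_fin => /par[].
- apply/measurable_EFinP; apply: measurable_funB; first exact: measurable_cst.
  by apply: measurable_funM; [exact: measurable_cst|exact: measurable_funX].
- by apply: measurable_funTS.
- by move=> t; rewrite /= in_itv /= lee_fin => /par[].
Qed.

Lemma integral_profile_fin k : (\int[mu]_t (profile k t)%:E < +oo)%E.
Proof.
apply: (@le_lt_trans _ _ (\int[mu]_t (\1_(`]-1, 1[%classic) t)%:E)%E).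
  apply: ge0_le_integral => //.
  - by move=> t _; rewrite lee_fin profile_ge0.
  - by apply/measurable_EFinP; exact: measurable_profile.
  - by apply/measurable_EFinP; exact: measurable_indic.
  move=> t _; rewrite lee_fin /profile ler_piMr // exprn_ile1 ?sqrtr_ge0 //.
  by rewrite -[leRHS]sqrtr1 ler_wsqrtr // gerBl sqr_ge0.
rewrite integral_indic // setIT.
have := @lebesgue_measure_itv R `]-1, 1[ => /= ->; rewrite ltey.
by case: ifP.
Qed.

(** The slice at height [t] of the ball of radius [r] is a ball of radius
    [sqrt (r^2 - t^2)]; homogeneity in dimension [k] and the substitution
    [t = r t'] bring out the factor [r^(k+1)]. *)
Lemma lebesgue_vol_ball_step k (b : R) : 0 < b ->
  (forall r, 0 < r -> lebesgue_vol (eball (0 : 'rV[R]_k) r) = (b * r ^+ k)%:E) ->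
  forall r, 0 < r -> (lebesgue_vol (eball (0%R : 'rV[R]_k.+1) r)
    = (b * r ^+ k.+1)%:E * \int[mu]_t (profile k t)%:E)%E.
Proof.
move=> b0 IH r r0 /=.
pose g (t : R) : \bar R := (b * r ^+ k * profile k (t / r))%:E.
have mg : measurable_fun setT g.
  apply/measurable_EFinP; apply: measurable_funM; first exact: measurable_cst.
  apply: (measurableT_comp (@measurable_profile k)).
  by apply: measurable_funM; [|exact: measurable_cst].
transitivity (\int[mu]_t g t)%E.
  apply: eq_integral => t _; rewrite ball_section // /g profileE.
  have -> : ((t / r) ^+ 2 < 1) = (t ^+ 2 < r ^+ 2).
    by rewrite expr_div_n ltr_pdivrMr ?exprn_gt0 // mul1r.
  case: ifPn => tr; last by rewrite lebesgue_vol0 mulr0.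
  rewrite IH ?sqrtr_gt0 ?subr_gt0 //; congr EFin; rewrite -mulrA -exprMn.
  have -> : r * Num.sqrt (1 - (t / r) ^+ 2) = Num.sqrt (r ^+ 2 * (1 - (t / r) ^+ 2)).
    by rewrite sqrtrM ?sqr_ge0 // sqrtr_sqr ger0_norm // ltW.
  by congr (_ * Num.sqrt _ ^+ _); field; rewrite gt_eqF.
rewrite (integral_dilation r0) //; last first.
  by move=> t; rewrite lee_fin !mulr_ge0 ?exprn_ge0 ?profile_ge0 ?(ltW b0) ?(ltW r0).
rewrite exprS mulrCA EFinM -muleA; congr (_ * _)%E.
rewrite -ge0_integralZl //; last first.
- by rewrite lee_fin mulr_ge0 ?exprn_ge0 ?(ltW b0) ?(ltW r0).
- by move=> t _; rewrite lee_fin profile_ge0.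
- by apply/measurable_EFinP; exact: measurable_profile.
apply: eq_integral => t _; rewrite /g -EFinM; congr (_ * profile _ _)%:E.
by rewrite mulrAC divff ?mul1r // gt_eqF.
Qed.

Lemma lebesgue_vol_ball k : exists2 b : R, 0 < b &
  forall r, 0 < r -> lebesgue_vol (eball (0 : 'rV[R]_k) r) = (b * r ^+ k)%:E.
Proof.
elim: k => [|k [b b0 IH]].
  exists 1 => // r r0 /=; rewrite expr0 mulr1 diracE mem_set //.
  by rewrite /eball /= subr0 enorm0.
have pos := integral_profile_ge k.
have fin : (\int[mu]_t (profile k t)%:E)%E \is a fin_num.
  rewrite ge0_fin_numE ?integral_profile_fin //.
  by apply: integral_ge0 => t _; rewrite lee_fin profile_ge0.
have I0 : 0 < ball_ratio k :> R := ball_ratio_gt0 k.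
exists (b * fine (\int[mu]_t (profile k t)%:E)%E).
  by rewrite mulr_gt0 // (lt_le_trans I0) // -lee_fin fineK.
move=> r r0; rewrite (lebesgue_vol_ball_step b0) // -[X in (_ * X)%E](fineK fin).
by rewrite -EFinM mulrAC.
Qed.

Lemma unit_ball_vol_gt0 k : 0 < unit_ball_vol R k.
Proof.
have [b b0 E] := lebesgue_vol_ball k.
by rewrite /unit_ball_vol E // expr1n mulr1.
Qed.

Lemma unit_ball_vol_ratio k :
  ball_ratio k * unit_ball_vol R k <= unit_ball_vol R k.+1.
Proof.
have [b b0 E] := lebesgue_vol_ball k.
rewrite /unit_ball_vol E // (lebesgue_vol_ball_step b0) //= !expr1n !mulr1.
have fin : (\int[mu]_t (profile k t)%:E)%E \is a fin_num.
  rewrite ge0_fin_numE ?integral_profile_fin //.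
  by apply: integral_ge0 => t _; rewrite lee_fin profile_ge0.
rewrite -(fineK fin) -EFinM /= mulrC ler_wpM2l ?(ltW b0) //.
by rewrite -lee_fin fineK // integral_profile_ge.
Qed.

End UnitBall.

(** * The numerical constant *)

Section Constants.
Context {R : realType}.

(** With [x = 1/d], [rho (1 + rho) = 6 (1 + 5 x / 6 + x^2 / 6)], and the [n]-th
    power of the last factor is at most [exp (5/6)]. *)
Lemma radius_growth n (rho : R) : (0 < n)%N -> rho = 2 + n.+1%:R^-1 ->
  rho ^+ 3 * (rho * (1 + rho)) ^+ n <= 128 / 5 * 6 ^+ n.
Proof.
move=> n0 ->.
have [n4|n4] := ltnP n 4.
  case: n n0 n4 => [|[|[|[|n]]]] // _ _; lra.
set x : R := n.+1%:R^-1.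
have n1 : 5 <= n.+1%:R :> R by rewrite ler_nat.
have nx : n.+1%:R * x = 1 by rewrite divff // gt_eqF //; lra.
have x0 : 0 < x by rewrite invr_gt0; lra.
have x5 : x <= 1 / 5.
  by rewrite div1r lef_pV2 ?posrE //; lra.
pose y := 5 / 6 * x + x ^+ 2 / 6.
have -> : (2 + x) * (1 + (2 + x)) = (1 + y) * 6 by rewrite /y; field.
rewrite exprMn mulrA ler_wpM2r ?exprn_ge0 //.
have y0 : 0 <= y by rewrite /y; nra.
have ny : n%:R * y <= 16 * (5 / 96).
  have -> : n%:R = n.+1%:R - 1 :> R by rewrite -natr1; lra.
  by rewrite /y; move: nx; set N := n.+1%:R => nx; nra.
(* exp (5/6) is obtained by squaring exp (5/96) four times *)
have e1 : expR (5 / 96) <= 96 / 91 :> R.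
  have := expR_ge1Dx (- (5 / 96) : R); rewrite expRN => H.
  have E0 := expR_gt0 (5 / 96 : R).
  have : (1 - 5 / 96) * expR (5 / 96) <= 1 :> R.
    by rewrite -ler_pdivlMr // div1r.
  by lra.
have e16 : expR (16 * (5 / 96)) <= 12 / 5 :> R.
  rewrite (_ : 16 = (2 * (2 * (2 * 2)))%:R) // expRM_natl !exprM.
  have E0 := expR_gt0 (5 / 96 : R).
  have step (a b c : R) : 0 <= a -> a <= b -> b ^+ 2 <= c -> a ^+ 2 <= c.
    by move=> a0 ab; apply: le_trans; rewrite lerXn2r ?nnegrE //; lra.
  apply: (step _ (15347 / 10000)); [by rewrite !exprn_ge0 ?ltW| |lra].
  apply: (step _ (12388 / 10000)); [by rewrite !exprn_ge0 ?ltW| |lra].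
  apply: (step _ (11130 / 10000)); [by rewrite !exprn_ge0 ?ltW| |lra].
  by apply: (step _ (96 / 91)); [rewrite ltW| |lra].
have a1 : (1 + y) ^+ n <= 12 / 5.
  apply: le_trans e16; apply: (@le_trans _ _ (expR (n%:R * y))).
    by rewrite expRM_natl lerXn2r ?nnegrE ?expR_ge1Dx ?expR_ge0 //; lra.
  by rewrite ler_expR.
have a0 : 0 <= (1 + y) ^+ n by rewrite exprn_ge0 //; lra.
have r3 : (2 + x) ^+ 3 <= (11 / 5) ^+ 3.
  by rewrite lerXn2r ?nnegrE //; lra.
have r0 : 0 <= (2 + x) ^+ 3 by rewrite exprn_ge0 //; lra.
apply: (@le_trans _ _ ((11 / 5) ^+ 3 * (12 / 5))); first exact: ler_pM.
lra.
Qed.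

Lemma sqr_ball_ratio n : (n.+1%:R + 1) * ball_ratio n ^+ 2 = 32 / 9 :> R.
Proof.
have n0 : 0 <= n%:R :> R by [].
rewrite /ball_ratio expr_div_n exprMn sqr_sqrtr; last lra.
by rewrite -natr1; field; lra.
Qed.

Lemma const_c_ge0 k : 0 <= const_c R k.
Proof.
rewrite /const_c mulr_ge0 // divr_ge0 ?(ltW (unit_ball_vol_gt0 _)) //.
by rewrite !mulr_ge0 ?(ltW (unit_ball_vol_gt0 _)) ?exprn_ge0 ?addr_ge0.
Qed.

(** The volume ratio in [const_c] is at least [ball_ratio n], which the left-hand
    side has in its denominator; [(d + 1) (ball_ratio n)^2 = 32/9] reconciles
    the two. The numbers then agree exactly: the factor [10/9] lost in [t] and
    the bound [128/5] of [radius_growth] multiply to [6 * 4/3 * 32/9]. *)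
Lemma flux_constant_le n (D eta M theta r t : R) : (0 < n)%N ->
  0 < eta -> eta <= D -> 0 < M -> 0 < theta -> theta <= 1 ->
  r = (2 + n.+1%:R^-1) * eta -> t = 9 / 10 * eta / n.+1%:R ->
  n.+1%:R / t * (r * r * (D + r) ^+ n / (eta ^+ n * (ball_ratio n * eta)))
    * (M * r `^ (n%:R + theta))
  <= const_c R n.+1 * M * (D `^ n%:R * eta `^ theta).
Proof.
move=> n0 eta0 etaD M0 th0 th1.
set rho : R := 2 + n.+1%:R^-1; set d : R := n.+1%:R in rho * => rE0 tE.
have d0 : 0 < d by rewrite ltr0n.
have rho2 : 2 < rho by rewrite /rho ltrDl invr_gt0.
have I0 := @ball_ratio_gt0 R n; set I := ball_ratio n in I0 *.
have c_ge : 4 / 3 * (6 ^+ n.+1 * d ^+ 2 * (d + 1) * I) <= const_c R n.+1.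
  rewrite /const_c -/d ler_wpM2l // -[leRHS]mulrA ler_wpM2l //.
    by rewrite !mulr_ge0 ?exprn_ge0 ?addr_ge0 // ltW.
  by rewrite /= ler_pdivlMr ?unit_ball_vol_gt0 // unit_ball_vol_ratio.
have rE : r `^ (n%:R + theta) <= rho ^+ n.+1 * (eta ^+ n * eta `^ theta).
  rewrite rE0 powRM ?(ltW eta0) //; last lra.
  apply: ler_pM; rewrite ?powR_ge0 //.
    rewrite -powR_mulrn; last lra.
    by apply: ler_powR; [lra|rewrite /d -natr1 lerD2l].
  rewrite powRD; last by rewrite (gt_eqF eta0) implybT.
  by rewrite powR_mulrn // ltW.
have DE : (D + r) ^+ n <= D ^+ n * (1 + rho) ^+ n.
  have h1 : 0 <= D + r by rewrite rE0; nra.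
  have h2 : D + r <= D * (1 + rho) by rewrite rE0; nra.
  by rewrite -exprMn lerXn2r // nnegrE (le_trans h1).
rewrite powR_mulrn; last lra.
set et := eta `^ theta in rE *.
have et0 : 0 <= et by exact: powR_ge0.
have en0 : 0 < eta ^+ n by rewrite exprn_gt0.
have Dn0 : 0 <= D ^+ n by rewrite exprn_ge0 //; lra.
pose A := (10 / 9) * d ^+ 2 * (rho ^+ 3 * (rho * (1 + rho)) ^+ n) / I * M * (D ^+ n * et).
have r0 : 0 < r by rewrite rE0; nra.
have t0 : 0 < t by rewrite tE divr_gt0 // mulr_gt0 //; lra.
have Dr : 0 <= D + r by lra.
apply: (@le_trans _ _ A).
  have -> : A = d / t * (r * r * (D ^+ n * (1 + rho) ^+ n) / (eta ^+ n * (I * eta)))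
      * (M * (rho ^+ n.+1 * (eta ^+ n * et))).
    rewrite /A rE0 tE exprMn !exprS; field.
    by rewrite !gt_eqF.
  apply: ler_pM.
  - by rewrite !mulr_ge0 ?invr_ge0 ?mulr_ge0 ?exprn_ge0 // ltW.
  - by rewrite mulr_ge0 ?powR_ge0 // ltW.
  - rewrite ler_wpM2l //; first by rewrite divr_ge0 // ltW.
    rewrite ler_wpM2r ?invr_ge0 ?mulr_ge0 ?(ltW en0) ?(ltW I0) ?(ltW eta0) //.
    by rewrite ler_wpM2l // mulr_ge0 // ltW.
  - by rewrite ler_wpM2l // ltW.
apply: (@le_trans _ _ (4 / 3 * (6 ^+ n.+1 * d ^+ 2 * (d + 1) * I) * M * (D ^+ n * et))).
  rewrite /A ler_wpM2r ?mulr_ge0 // ler_wpM2r ?(ltW M0) // ler_pdivrMr //.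
  have growth := radius_growth n0 (erefl rho).
  have II := sqr_ball_ratio n; rewrite -/d -/I in II.
  have -> : 4 / 3 * (6 ^+ n.+1 * d ^+ 2 * (d + 1) * I) * I
      = 4 / 3 * (6 ^+ n.+1 * d ^+ 2 * ((d + 1) * I ^+ 2)) by ring.
  rewrite II.
  have -> : 4 / 3 * (6 ^+ n.+1 * d ^+ 2 * (32 / 9))
      = 10 / 9 * d ^+ 2 * (128 / 5 * 6 ^+ n) :> R by rewrite exprS; field.
  by rewrite ler_wpM2l // mulr_ge0 // exprn_ge0 // ltW.
by rewrite ler_wpM2r ?mulr_ge0 // ler_wpM2r // ltW.
Qed.

End Constants.

(** * Balancing the two terms of the estimate *)

Section TailBounds.
Context {R : realType} {d : nat}.
Local Notation E := 'rV[R]_d.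
Variable sigma : probability (E * E)%type R.
Local Open Scope ereal_scope.

(** Markov's inequality for the power [r] of the distance. *)
Lemma Lnorm_tail (r w eta : R) : (0 < r)%R -> (0 <= w)%R -> (0 < eta)%R ->
  Lnorm sigma r%:E (fun z => (enorm (z.1 - z.2)%R)%:E) < w%:E ->
  sigma [set z | (eta <= enorm (z.1 - z.2))%R] <= ((w / eta) `^ r)%:E.
Proof.
move=> r0 w0 eta0; rewrite unlock.
have mf : measurable_fun setT (fun z : E * E => enorm (z.1 - z.2) `^ r)%R.
  apply: (measurableT_comp (f := fun x : R => x `^ r)%R) => //.
  exact: measurable_dist.
under eq_integral do rewrite abse_EFin ger0_norm ?enorm_ge0 // poweR_EFin.
set J := \int[sigma]_z _ => Jw.
have J0 : 0 <= J by apply: integral_ge0 => z _; rewrite lee_fin powR_ge0.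
have Jr : J <= (w `^ r)%:E.
  case: J J0 Jw => [j| |] //.
    rewrite lee_fin poweR_EFin lte_fin => j0 jw; rewrite lee_fin.
    have -> : (j = (j `^ r^-1) `^ r)%R by rewrite -powRrM mulVf ?gt_eqF // powRr1.
    by rewrite ge0_ler_powR ?nnegrE ?powR_ge0 ?(ltW r0) ?(ltW jw).
  by move=> _; rewrite poweRyr ?gt_eqF ?invr_gt0 // ltNge leey.
have etar : (0 < eta `^ r)%R by rewrite powR_gt0.
have markov : (eta `^ r)%:E * sigma [set z | (eta <= enorm (z.1 - z.2))%R] <= J.
  set far := [set z | _]; have mfar : measurable far := measurable_far eta.
  rewrite -(setIT far) -integral_indic // -ge0_integralZl //; last 2 first.
  - by apply/measurable_EFinP; exact: measurable_indic.
  - by rewrite lee_fin ltW.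
  apply: ge0_le_integral => //.
  - by move=> z _; rewrite -EFinM lee_fin mulr_ge0 // ltW.
  - apply: measurable_funeM; apply/measurable_EFinP; exact: measurable_indic.
  - exact/measurable_EFinP.
  move=> z _; rewrite -EFinM lee_fin indicE.
  have [zf|zf] := boolP (z \in far); last by rewrite mulr0 powR_ge0.
  rewrite mulr1 ge0_ler_powR ?nnegrE ?enorm_ge0 ?(ltW r0) ?(ltW eta0) //.
  exact: (set_mem zf).
have sfin : sigma [set z | (eta <= enorm (z.1 - z.2))%R] \is a fin_num.
  by apply: fin_num_measure; exact: measurable_far.
have := le_trans markov Jr; rewrite -(fineK sfin) -EFinM !lee_fin => H.
rewrite powRM ?invr_ge0 ?(ltW eta0) // -powR_inv1 ?(ltW eta0) // -powRrM mulrC mulN1r powRN.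
by rewrite ler_pdivlMl.
Qed.

Lemma Lnormy_tail (w : R) :
  Lnorm sigma +oo (fun z => (enorm (z.1 - z.2)%R)%:E) < w%:E ->
  sigma [set z | (w <= enorm (z.1 - z.2))%R] = 0.
Proof.
have s1 : 0 < sigma [set: E * E] by rewrite probability_setT lte01.
rewrite unlock; case: ifPn => [_|/negP[]]; last exact: s1.
move=> /ereal_inf_lt[y /= [N [mN N0 sub]] yw].
apply/eqP; rewrite eq_le measure_ge0 andbT -N0; apply: le_measure; rewrite ?inE //.
  exact: measurable_far.
move=> z /= wz; apply: sub => /= zy; have := le_lt_trans zy yw.
by rewrite lte_fin ger0_norm ?enorm_ge0 // ltNge wz.
Qed.

End TailBounds.

Section Assembly.
Context {R : realType}.

Lemma le_of_dilated (x : \bar R) (a k : R) : 0 <= k ->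
  (forall b, a < b -> (x <= (b * k)%:E)%E) -> (x <= (a * k)%:E)%E.
Proof.
move=> k0 H; apply/lee_addgt0Pr => e e0.
have k1 : 0 < k + 1 by rewrite ltr_wpDl.
have ek : 0 < e / (k + 1) by rewrite divr_gt0.
apply: le_trans (H (a + e / (k + 1)) _) _; first by rewrite ltrDl.
rewrite -EFinD lee_fin mulrDl lerD2l mulrAC ler_pdivrMr // ler_wpM2l ?(ltW e0) //.
by rewrite lerDl.
Qed.

(** Right continuity of the power, in the form needed to pass from all
    [w > w0] to an infimum [w0] that may be zero. *)
Lemma le_of_right_powers (p C w0 D nu : R) : 0 <= p -> 0 <= C -> 0 <= w0 ->
  w0 < D -> 0 < nu -> (forall w, w0 < w -> w <= D -> p <= C * w `^ nu) ->
  p <= C * w0 `^ nu.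
Proof.
move=> p0 C0 w00 w0D nu0 H; have [C00|C00] := eqVneq C 0.
  by have := H D w0D (lexx _); rewrite C00 !mul0r.
have Cp : 0 < C by rewrite lt_neqAle eq_sym C00.
rewrite [leRHS]mulrC -ler_pdivrMr //.
have pC0 : 0 <= p / C by rewrite divr_ge0.
set y := (p / C) `^ nu^-1.
have yE : y `^ nu = p / C by rewrite /y -powRrM mulVf ?gt_eqF // powRr1.
have y0 : 0 <= y by exact: powR_ge0.
have [yw|yw] := leP y w0; first by rewrite -yE ge0_ler_powR ?nnegrE // ltW.
pose w := Num.min D ((w0 + y) / 2).
have w0w : w0 < w by rewrite /w lt_min w0D; lra.
have wy : w < y by rewrite /w gt_min; apply/orP; right; lra.
have := H w w0w; rewrite /w ge_min lexx => /(_ erefl).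
rewrite -/w [leRHS]mulrC -ler_pdivrMr // -yE leNgt gt0_ltr_powR ?nnegrE //.
by rewrite (le_trans w00) // ltW.
Qed.

Lemma exponent_nu_bounds (q theta : R) (r : \bar R) : 1 <= q -> (1%:E <= r)%E ->
  0 < theta -> theta <= 1 -> 0 < exponent_nu q r theta <= 1.
Proof.
move=> q1; case: r => [r| |] //=; rewrite ?lee_fin => r1 th0 th1.
  apply/andP; split; first by rewrite divr_gt0 ?mulr_gt0 //; lra.
  rewrite ler_pdivrMr ?mulr_gt0 //; try lra.
  by rewrite mul1r; nra.
apply/andP; split; first by rewrite divr_gt0 //; lra.
by rewrite ler_pdivrMr; lra.
Qed.

Context {n : nat}.
Local Notation d := n.+1.
Local Notation E := 'rV[R]_d.

(** If [X] were a single point, every ball around it would have full mass. *)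
Lemma ediam_gt0 (X : set E) (rhot : probability E R) (M alpha : R) :
  compact X -> probs_on X rhot -> 0 < M -> 0 < alpha ->
  (forall x eta, 0 < eta -> (rhot (eball x eta) <= (M * eta `^ alpha)%:E)%E) ->
  0 < ediam X.
Proof.
move=> cX rX M0 al0 ball; rewrite ltNge; apply/negP => X0.
have [x Xx] : exists x, X x.
  apply/set0P; apply/eqP => Xe; have := rX; rewrite /probs_on /= Xe measure0.
  by move=> /esym/eqP; rewrite onee_eq0.
pose eta := (1 / (2 * M)) `^ alpha^-1.
have e0 : 0 < eta by rewrite powR_gt0 // divr_gt0 // mulr_gt0.
have := ball x eta e0; rewrite -powRrM mulVf ?gt_eqF // powRr1; last first.
  by rewrite divr_ge0 // mulr_ge0 // ltW.
rewrite (_ : M * _ = 1 / 2); last by field; rewrite gt_eqF.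
have : (rhot X <= rhot (eball x eta))%E.
  apply: le_measure; rewrite ?inE; [exact: compact_measurable_rV|exact: measurable_eball|].
  by move=> y Xy; rewrite /eball /= (le_lt_trans (enorm_le_ediam cX Xy Xx)) // (le_lt_trans X0).
by rewrite rX => /le_trans /[apply]; rewrite lee_fin; lra.
Qed.

Section Bound.
Variables (q : R) (X Y : set E) (M theta : R) (rhot rho mu : probability E R).
Variables gamma0 gamma1 : probability (E * E)%type R.
Hypotheses (n0 : (0 < n)%N) (q1 : 1 <= q) (cX : compact X) (cY : compact Y).
Hypotheses (M0 : 0 < M) (theta0 : 0 < theta) (theta1 : theta <= 1).
Hypothesis tX : probs_on X rhot.
Hypothesis ball : forall x eta, 0 < eta ->
  (rhot (eball x eta) <= (M * eta `^ (n%:R + theta))%:E)%E.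
Hypotheses (rX : probs_on X rho) (mY : probs_on Y mu).
Hypotheses (opt0 : optimal_plans rho mu gamma0) (opt1 : optimal_plans rho mu gamma1).

Local Notation D := (ediam X).
Local Notation c := (const_c R d * M * D `^ (n%:R + theta)).

(** The radii of [main_estimate] proportional to [eta]: [s = eta], [t] slightly
    below [eta / d], and [r] slightly above their sum with [eta]. *)
Lemma plan_distance_tail sigma eta b : couplings rho rhot sigma ->
  0 < eta -> eta <= D -> ediam Y < b ->
  (plan_wasserstein q gamma0 gamma1
   <= ((b `^ q)%:E * ((c * (eta / D) `^ theta)%:E
        + sigma [set z | (eta <= enorm (z.1 - z.2))%R])) `^ q^-1)%E.
Proof.
move=> coup eta0 etaD Yb; have D0 : 0 < D by lra.
pose r := (2 + d%:R^-1) * eta; pose t := 9 / 10 * eta / d%:R.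
have d0 : 0 < d%:R :> R by [].
have t0 : 0 < t by rewrite /t divr_gt0 // mulr_gt0.
have etar : eta + t + eta < r.
  have ed : 0 < eta / d%:R by rewrite divr_gt0.
  have -> : t = 9 / 10 * (eta / d%:R) by rewrite /t mulrA.
  have -> : r = 2 * eta + eta / d%:R by rewrite /r mulrDl [_^-1 * _]mulrC.
  move: (eta / d%:R) ed => u u0; lra.
have r0 : 0 < r by lra.
have m0 : 0 <= M * r `^ (n%:R + theta) by rewrite mulr_ge0 ?powR_ge0 // ltW.
have XD x x' : X x -> X x' -> enorm (x - x') <= D by exact: enorm_le_ediam.
have YD y y' : Y y -> Y y' -> enorm (y - y') <= ediam Y by exact: enorm_le_ediam.
have := main_estimate n0 q1 cX cY rX mY tX opt0 opt1 coup t0 eta0 (ltW eta0) etar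
  XD YD Yb m0 (fun z => ball z r0).
rewrite /plan_wasserstein; set J := ereal_inf _ => HJ.
have J0 : (0 <= J)%E.
  apply: le_ereal_inf_tmp => _ [pi _ <-]; apply: integral_ge0 => z _.
  by rewrite lee_fin addr_ge0 // powR_ge0.
have qV : 0 <= q^-1 by rewrite invr_ge0 (le_trans ler01 q1).
have HJ' : (J <= (b `^ q)%:E * ((c * (eta / D) `^ theta)%:E
        + sigma [set z | (eta <= enorm (z.1 - z.2))%R]))%E.
  apply: le_trans HJ _; rewrite ge0_muleDr ?lee_fin //; last first.
    rewrite mulr_ge0 ?powR_ge0 // mulr_ge0 ?powR_ge0 // mulr_ge0 ?(ltW M0) //.
    exact: const_c_ge0.
  rewrite leeD2r // -EFinM lee_fin ler_wpM2l ?powR_ge0 //.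
  apply: le_trans (flux_constant_le n0 eta0 etaD M0 theta0 theta1 erefl erefl) _.
  have c0 := const_c_ge0 (R := R) d; move: (const_c R d) c0 => c0 c00.
  rewrite -[leRHS]mulrA ler_wpM2l //; first by rewrite mulr_ge0 // ltW.
  rewrite powRD; last by rewrite (gt_eqF D0) implybT.
  rewrite -mulrA ler_wpM2l ?powR_ge0 // -powRM ?divr_ge0 ?(ltW D0) ?(ltW eta0) //.
  by rewrite [D * _]mulrC divfK // gt_eqF.
apply: gt0_ler_poweR => //; rewrite in_itv /= leey andbT //.
exact: le_trans HJ'.
Qed.

Lemma c_ge0 : 0 <= c.
Proof. by rewrite mulr_ge0 ?powR_ge0 // mulr_ge0 ?(ltW M0) ?const_c_ge0. Qed.

Lemma plan_distance_root sigma eta b K : couplings rho rhot sigma ->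
  0 < eta -> eta <= D -> ediam Y < b -> 0 <= b ->
  ((c * (eta / D) `^ theta)%:E + sigma [set z | (eta <= enorm (z.1 - z.2))%R]
    <= K%:E)%E ->
  (plan_wasserstein q gamma0 gamma1 <= (b * K `^ q^-1)%:E)%E.
Proof.
move=> coup eta0 etaD Yb b0 HK.
have q0 : 0 < q := lt_le_trans ltr01 q1.
have S0 : (0 <= (c * (eta / D) `^ theta)%:E
    + sigma [set z | (eta <= enorm (z.1 - z.2))%R])%E.
  by rewrite adde_ge0 // lee_fin mulr_ge0 ?powR_ge0 ?c_ge0.
have K0 : 0 <= K by rewrite -lee_fin (le_trans S0).
apply: le_trans (plan_distance_tail coup eta0 etaD Yb) _.
apply: (@le_trans _ _ (((b `^ q)%:E * K%:E) `^ q^-1)%E).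
  apply: gt0_ler_poweR; rewrite ?in_itv /= ?leey ?andbT ?invr_ge0 ?(ltW q0) //.
  - by rewrite mule_ge0 ?lee_fin ?powR_ge0.
  - by rewrite lee_fin mulr_ge0 ?powR_ge0.
  - by apply: lee_wpmul2l; rewrite ?lee_fin ?powR_ge0.
by rewrite -EFinM poweR_EFin powRM ?powR_ge0 // -powRrM divff ?gt_eqF // powRr1.
Qed.

(** For [eta = D] the far set has mass at most [1] whatever the coupling. *)
Lemma plan_distance_le_all b : 0 < D -> ediam Y < b -> 0 <= b ->
  (plan_wasserstein q gamma0 gamma1 <= (b * (c + 1) `^ q^-1)%:E)%E.
Proof.
move=> D0 Yb b0.
have coup : couplings rho rhot (indep rho rhot).
  by split=> A mA; rewrite /pushforward ?indep_fst ?indep_snd.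
apply: (plan_distance_root coup D0 (lexx _) Yb b0).
rewrite divff ?gt_eqF // powR1 mulr1 EFinD leeD2l // probability_le1 //.
exact: measurable_far.
Qed.

(** For a finite [r], [eta] is chosen so that [(eta / D)^theta] and the tail
    [(w / eta)^r] are equal; for an infinite one, [eta = w] and the tail
    vanishes. *)
Lemma plan_distance_le_norm (r : \bar R) sigma w b : (1%:E <= r)%E ->
  couplings rho rhot sigma ->
  (Lnorm sigma r (fun z => (enorm (z.1 - z.2)%R)%:E) < w%:E)%E ->
  0 < w -> w <= D -> ediam Y < b -> 0 <= b ->
  (plan_wasserstein q gamma0 gamma1
    <= (b * ((c + 1) `^ q^-1 * (w / D) `^ exponent_nu q r theta))%:E)%E.
Proof.
move=> r1 coup Lw w0 wD Yb b0; have D0 : 0 < D by lra.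
have q0 : 0 < q := lt_le_trans ltr01 q1.
have wD0 : 0 <= w / D by rewrite divr_ge0 // ltW.
have -> : (c + 1) `^ q^-1 * (w / D) `^ exponent_nu q r theta
    = ((c + 1) * (w / D) `^ (exponent_nu q r theta * q)) `^ q^-1.
  rewrite powRM ?powR_ge0 ?addr_ge0 ?c_ge0 // -powRrM mulfK ?gt_eqF //.
case: r r1 Lw => [r| |] //; rewrite ?lee_fin => r1 Lw /=.
  have r0 : 0 < r by lra.
  have rt : 0 < r + theta by rewrite addr_gt0.
  pose eta := D * (w / D) `^ (r / (r + theta)).
  have wDp : 0 < w / D by rewrite divr_gt0.
  have wD1 : w / D <= 1 by rewrite ler_pdivrMr // mul1r.
  have eta0 : 0 < eta by rewrite mulr_gt0 // powR_gt0.
  have etaD : eta <= D.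
    rewrite -[leRHS]mulr1 ler_wpM2l ?(ltW D0) // -[leRHS](powRr0 (w / D)).
    by apply: ger_powR; rewrite ?wDp // divr_ge0 // ltW.
  have etaE : eta / D = (w / D) `^ (r / (r + theta)).
    by rewrite /eta mulrAC divff ?mul1r // gt_eqF.
  apply: (plan_distance_root coup eta0 etaD Yb b0).
  have tail := Lnorm_tail r0 (ltW w0) eta0 Lw.
  apply: (@le_trans _ _ ((c * (eta / D) `^ theta)%:E + ((w / eta) `^ r)%:E)%E).
    by rewrite leeD2l.
  have nuE : r * theta / (q * (r + theta)) * q = r * theta / (r + theta).
    by field; rewrite !gt_eqF.
  rewrite nuE -EFinD lee_fin mulrDl mul1r etaE -powRrM (mulrAC r) lerD //.
  have -> : w / eta = (w / D) `^ (theta / (r + theta)).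
    have -> : theta / (r + theta) = 1 - r / (r + theta) by field; rewrite gt_eqF.
    rewrite powRB ?powRr1 // ?(gt_eqF wDp) ?implybT //.
    by rewrite /eta invfM mulrA.
  by rewrite -powRrM mulrAC (mulrC theta).
have wq : theta / q * q = theta by rewrite divfK // gt_eqF.
apply: (plan_distance_root coup w0 wD Yb b0).
by rewrite (Lnormy_tail Lw) adde0 wq lee_fin ler_wpM2r ?powR_ge0 // lerDl.
Qed.

End Bound.
End Assembly.

Theorem theorem3p1 (R : realType) (d : nat) (hd : (2 <= d)%N)
    (q : R) (hq : 1 <= q) (r : \bar R) (hr : (1%:E <= r)%E)
    (X Y : set 'rV[R]_d)
    (hXcompact : compact X) (hXconvex : convex_set X)
    (hYcompact : compact Y) (hYconvex : convex_set Y)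
    (M : R) (hM : 0 < M)
    (theta : R) (htheta0 : 0 < theta) (htheta1 : theta <= 1)
    (rhot : probability 'rV[R]_d R) (hrhot : probs_on X rhot)
    (hball : forall (x : 'rV[R]_d) (eta : R), 0 < eta ->
      (rhot (eball x eta) <= (M * eta `^ (d%:R - 1 + theta))%:E)%E) :
  let nu := exponent_nu q r theta in
  let C := const_C q r X Y M theta in
  [/\ 0 < nu <= 1,
      (0 < ediam Y -> 0 < C) &
      forall rho mu : probability 'rV[R]_d R,
        probs_on X rho -> probs_on Y mu ->
        (diam_wasserstein q (optimal_plans rho mu)
           <= C%:E * (wasserstein r rho rhot) `^ nu)%E].
Proof.
case: d hd X Y hXcompact hXconvex hYcompact hYconvex rhot hrhot hball
  => [//|n] n0 X Y cX _ cY _ rhot tX ball nu C.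
have q0 : 0 < q := lt_le_trans ltr01 hq.
have {}ball x eta : 0 < eta -> (rhot (eball x eta) <= (M * eta `^ (n%:R + theta))%:E)%E.
  by move=> /(ball x); rewrite -natr1 addrK.
have D0 : 0 < ediam X.
  by apply: (ediam_gt0 cX tX hM _ ball); rewrite ltr_wpDl.
have nu01 : 0 < nu <= 1 by exact: exponent_nu_bounds.
have /andP[nu0 _] := nu01.
set c := const_c R n.+1 * M * ediam X `^ (n%:R + theta).
have c0 : 0 <= c by exact: c_ge0.
pose k := (c + 1) `^ q^-1.
have k0 : 0 < k by rewrite powR_gt0 // ltr_wpDl.
have CE : C = ediam Y * (k * ediam X `^ (- nu)).
  by rewrite /C /const_C -natr1 addrK mulrA.
split=> //.
  by move=> Y0; rewrite CE mulr_gt0 // mulr_gt0 // powR_gt0.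
move=> rho mu rX mY; have Y0 : 0 <= ediam Y.
  have [y Yy] : exists y, Y y.
    apply/set0P; apply/eqP => Ye; have := mY; rewrite /probs_on /= Ye measure0.
    by move=> /esym/eqP; rewrite onee_eq0.
  by apply: le_trans (enorm_le_ediam cY Yy Yy); exact: enorm_ge0.
have C0 : 0 <= C by rewrite CE !mulr_ge0 ?powR_ge0 // ltW.
set W := wasserstein r rho rhot.
have W0 : (0 <= W)%E.
  by apply: le_ereal_inf_tmp => _ [g _ <-]; exact: Lnorm_ge0.
have CwE w : 0 <= w -> C * w `^ nu = ediam Y * (k * (w / ediam X) `^ nu).
  move=> w0; rewrite CE powRM ?invr_ge0 ?(ltW D0) // -powR_inv1 ?(ltW D0) //.
  by rewrite -powRrM mulN1r; ring.
apply: ge_ereal_sup => _ [g0 opt0 [g1 opt1 <-]].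
have P0 : (0 <= plan_wasserstein q g0 g1)%E by exact: poweR_ge0.
have all_bound : (plan_wasserstein q g0 g1 <= (C * ediam X `^ nu)%:E)%E.
  rewrite CwE ?(ltW D0) // divff ?gt_eqF // powR1 mulr1.
  apply: le_of_dilated => [|b Yb]; first exact: ltW.
  by apply: (plan_distance_le_all n0 hq cX cY hM htheta0 htheta1 tX ball rX mY opt0 opt1);
    rewrite // (le_trans Y0) // ltW.
have [DW|WD] := leP (ediam X)%:E W.
  apply: le_trans all_bound _; rewrite EFinM; apply: lee_wpmul2l; rewrite ?lee_fin //.
  rewrite -poweR_EFin; apply: gt0_ler_poweR; rewrite ?in_itv /= ?leey ?andbT ?lee_fin ?(ltW nu0) ?(ltW D0) //.
have Wfin : W \is a fin_num by rewrite ge0_fin_numE // (lt_trans WD) // ltry.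
have Pfin : plan_wasserstein q g0 g1 \is a fin_num.
  by rewrite ge0_fin_numE // (le_lt_trans all_bound) // ltry.
rewrite -(fineK Wfin) -(fineK Pfin) poweR_EFin -EFinM lee_fin.
apply: (@le_of_right_powers _ _ _ _ (ediam X)) => //.
- by rewrite -lee_fin fineK.
- by rewrite -lee_fin fineK.
- by rewrite -lte_fin fineK.
move=> w Ww wD; rewrite -lee_fin fineK //.
have w0 : 0 < w by apply: le_lt_trans Ww; rewrite -lee_fin fineK.
rewrite CwE ?(ltW w0) //.
have /ereal_inf_lt[_ [sigma coup <-] Lw] : (W < w%:E)%E by rewrite -(fineK Wfin) lte_fin.
apply: le_of_dilated => [|b Yb]; first by rewrite mulr_ge0 ?powR_ge0 // ltW.
by apply: (plan_distance_le_norm n0 hq cX cY hM htheta0 htheta1 tX ball rX mY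
  opt0 opt1 hr coup Lw w0 wD Yb); rewrite (le_trans Y0) // ltW.
Qed.
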